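(* Let $\lambda>0$, $\lambda\ne1$, let $B=B(0,1)\subset\mathbb{R}^2$ be the open unit ball, and endow $\mathbb{R}^2$ with the ball density $f=\lambda$ on $B$, $f=1$ on $\mathbb{R}^2\setminus\overline B$, $f=\min\{1,\lambda\}$ on $\partial B$. Then isoperimetric sets exist for any given area $v>0$.
   Context: For a positive lower semicontinuous density $f$ on $\mathbb{R}^2$: $|E|_f=\int_E f\,dx$ and $P_f(E)=\liminf_h\int_{\partial E_h}f\,d\mathcal{H}^1$, the $\liminf$ being taken among all smooth sets $E_h\to E$ in $L^1$. An isoperimetric set of area $v$ minimises $P_f$ among sets with $|\cdot|_f=v$. *)

(* Defs.v *)
From HB Require Import structures.
From mathcomp Require Import all_boot all_order all_algebra.
From mathcomp Require Import all_classical all_reals all_analysis.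
Import Order.TTheory GRing.Theory Num.Theory.
Import numFieldNormedType.Exports.

Set Implicit Arguments.
Unset Strict Implicit.
Unset Printing Implicit Defensive.

Local Open Scope classical_set_scope.
Local Open Scope ring_scope.

Section euclidean_plane.
Context {R : realType}.
Implicit Types (p q : R * R) (A U E : set (R * R)).

(* The library norm on R * R is the max norm, so the Euclidean distance has to
   be spelled out; the induced topology is the same. *)
Definition eucl_dist p q : R :=
  Num.sqrt ((p.1 - q.1) ^+ 2 + (p.2 - q.2) ^+ 2).

(* The point 0 is added because ereal_sup set0 = -oo. *)
Definition eucl_diam U : \bar R :=
  ereal_sup (0%E |` [set (eucl_dist p q)%:E | p in U & q in U]).

Definition boundary E : set (R * R) := closure E `\` E°.

End euclidean_plane.

Section hausdorff_measure.
Context {R : realType}.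
Implicit Types (A : set (R * R)) (U : (set (R * R))^nat) (delta : R).
Local Open Scope ereal_scope.

Definition hausdorff1_cover delta A : set ((set (R * R))^nat) :=
  [set U | A `<=` \bigcup_k U k /\ forall k, eucl_diam (U k) <= delta%:E].

Definition hausdorff1_pre delta A : \bar R :=
  ereal_inf [set \sum_(k <oo) eucl_diam (U k) | U in hausdorff1_cover delta A].

Definition hausdorff1 A : \bar R :=
  ereal_sup [set hausdorff1_pre delta A | delta in [set d | (0 < d)%R]].

Lemma eucl_diam_ge0 (V : set (R * R)) : 0 <= eucl_diam V.
Proof. by apply: ereal_sup_ubound; left. Qed.

Lemma eucl_diam0 : eucl_diam (set0 : set (R * R)) = 0.
Proof.
rewrite /eucl_diam (_ : [set _ | _ in _ & _ in _] = set0); last first.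
  by rewrite -subset0 => x [].
by rewrite setU0 ereal_sup1.
Qed.

Lemma hausdorff1_pre_ge0 delta A : 0 <= hausdorff1_pre delta A.
Proof.
apply: le_ereal_inf_tmp => _ [U _ <-].
by apply: nneseries_ge0 => k _ _; exact: eucl_diam_ge0.
Qed.

Lemma hausdorff1_ge0 A : 0 <= hausdorff1 A.
Proof.
apply: le_trans (hausdorff1_pre_ge0 1 A) _.
by apply: ereal_sup_ubound; exists 1%R => //=; exact: ltr01.
Qed.

Lemma hausdorff1_0 : hausdorff1 set0 = 0.
Proof.
apply/eqP; rewrite eq_le hausdorff1_ge0 andbT.
apply: ge_ereal_sup => _ [d /= d0 <-].
apply: ereal_inf_lbound; exists (fun=> set0).
  by split=> // k; rewrite eucl_diam0 lee_fin ltW.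
by apply: eseries0 => k _ _; exact: eucl_diam0.
Qed.

Lemma hausdorff1_pre_sigma_subadditive delta A (F : (set (R * R))^nat) :
  A `<=` \bigcup_n F n ->
  hausdorff1_pre delta A <= \sum_(n <oo) hausdorff1_pre delta (F n).
Proof.
move=> AF.
have [[i ioo]|] := pselect (exists i, hausdorff1_pre delta (F i) = +oo).
  rewrite (eseries_pinfty _ _ ioo)// ?leey// => n _.
  by rewrite -ltNye (lt_le_trans _ (hausdorff1_pre_ge0 _ _)).
rewrite -forallNE => Foo.
apply/lee_addgt0Pr => _/posnumP[e].
rewrite (le_trans _ (epsilon_trick _ _ _))//; last first.
  by move=> n; exact: hausdorff1_pre_ge0.
pose P n (U : (set (R * R))^nat) := hausdorff1_cover delta (F n) U /\
  \sum_(k <oo) eucl_diam (U k) <=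
    hausdorff1_pre delta (F n) + (e%:num / (2 ^ n.+1)%:R)%:E.
have [G PG] : {G : ((set (R * R))^nat)^nat & forall n, P n (G n)}.
  apply: (@choice _ _ P) => n; rewrite /P.
  have e2n : (0 < e%:num / (2 ^ n.+1)%:R)%R by rewrite divr_gt0// ltr0n expn_gt0.
  have fin : hausdorff1_pre delta (F n) \is a fin_num.
    by rewrite ge0_fin_numE ?hausdorff1_pre_ge0// ltey; apply/eqP/Foo.
  have [_ [U [? ?] <-] UF] := lb_ereal_inf_adherent e2n fin.
  by exists U; split => //; exact: ltW.
have /card_esym/ppcard_eqP[f] := card_nat2.
apply: (@le_trans _ _ (\esum_(i in setT) (@eucl_diam R \o uncurry G) i)).
  apply: ereal_inf_lbound; exists (uncurry G \o f).
    split => [t /AF[n _ /(PG n).1.1[k _ Gt]]|k /=].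
      by exists (f^-1%FUN (n, k)) => //=; rewrite invK ?inE.
    by rewrite /uncurry; case: (f k) => a b; exact: (PG a).1.2.
  rewrite nneseries_esumT; last by move=> n; exact: eucl_diam_ge0.
  by rewrite [RHS](reindex_esum [set: nat] _ f).
rewrite (_ : esum _ _ = \sum_(i <oo) \sum_(j <oo) eucl_diam (G i j)); last first.
  rewrite nneseries_esumT; last first.
    by move=> n; apply: nneseries_ge0 => k _ _; exact: eucl_diam_ge0.
  transitivity (\esum_(i in setT) \esum_(j in setT) eucl_diam (G i j)).
    rewrite esum_esum//; last by move=> *; exact: eucl_diam_ge0.
    apply: esym; rewrite (_ : setT `*`` _ = setT); last first.
      by rewrite predeqE => -[].
    by apply: eq_esum => -[].
  apply: eq_esum => n _; rewrite nneseries_esumT// => k; exact: eucl_diam_ge0.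
apply: lee_nneseries => [n _ _|n _]; last exact: (PG n).2.
by apply: nneseries_ge0 => m _ _; exact: eucl_diam_ge0.
Qed.

Lemma hausdorff1_sigma_subadditive A (F : (set (R * R))^nat) :
  subset_sigma_subadditive hausdorff1 A F.
Proof.
move=> AF; apply: ge_ereal_sup => _ [d d0 <-].
apply: le_trans (hausdorff1_pre_sigma_subadditive d AF) _.
apply: lee_nneseries => [n _ _|n _]; first exact: hausdorff1_pre_ge0.
by apply: ereal_sup_ubound; exists d.
Qed.

HB.instance Definition _ := isSubsetOuterMeasure.Build R (R * R)%type hausdorff1
  hausdorff1_0 hausdorff1_ge0 hausdorff1_sigma_subadditive.

End hausdorff_measure.

Section weighted_perimeter.
Context {R : realType}.
Implicit Types (f : R * R -> R) (E : set (R * R)) (v : R).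

(* Completing the Borel product measure yields the Lebesgue measure of the plane
   on the sigma-algebra of all Lebesgue measurable sets. *)
Definition lebesgue2_borel :
    {measure set (measurableTypeR R * measurableTypeR R) -> \bar R} :=
  (lebesgue_measure \x lebesgue_measure)%E.
Definition lebesgue2 := @completed_measure_extension _ _ R lebesgue2_borel.

Definition lebesgue2_measurable E : Prop := (lebesgue2_borel^*)%mu.-cara.-measurable E.

Definition weighted_area f E : \bar R := (\int[lebesgue2]_(x in E) (f x)%:E)%E.

(* Integral over the sigma-algebra of Caratheodory H^1-measurable sets, which
   contains the Borel sets. *)
Definition weighted_length f (C : set (R * R)) : \bar R :=
  (\int[hausdorff1 : set (caratheodory_type hausdorff1) -> \bar R]_(x in C)
    (f x)%:E)%E.

Definition smooth (g : R -> R) := forall n x, derivable (derive1n n g) x 1.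

(* The points strictly on one side of the graph of g, up to exchanging the two
   coordinates and reversing the second one. *)
Definition strict_side (swap flip : bool) (g : R -> R) : set (R * R) :=
  [set y | let: (s, t) := if swap then (y.2, y.1) else y in
           if flip then t < g s else g s < t].

(* Open sets lying locally on one side of their boundary, which is locally the
   graph of a C^infty function; no boundedness is required. *)
Definition smooth_set E :=
  open E /\
  forall x, boundary E x ->
    exists (swap flip : bool) (g : R -> R) (r : R),
      [/\ smooth g, 0 < r &
          forall y, eucl_dist x y < r -> (E y <-> strict_side swap flip g y)].

Definition cvg_L1 (Eh : (set (R * R))^nat) E :=
  (\int[lebesgue2]_x `|\1_(Eh h) x - \1_E x|%:E)%E @[h --> \oo] --> 0%E.

(* The infimum, over all approximating sequences, of the lower limits. *)
Definition perimeter f E : \bar R :=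
  ereal_inf [set limn_einf (fun h => weighted_length f (boundary (Eh h))) |
    Eh in [set Eh | (forall h, smooth_set (Eh h)) /\ cvg_L1 Eh E]].

Definition isoperimetric_set f v E :=
  [/\ lebesgue2_measurable E, weighted_area f E = v%:E &
      forall F, lebesgue2_measurable F -> weighted_area f F = v%:E ->
        (perimeter f E <= perimeter f F)%E].

Definition ball_density (lambda : R) (x : R * R) : R :=
  if eucl_dist x 0 < 1 then lambda
  else if 1 < eucl_dist x 0 then 1
  else Num.min 1 lambda.

End weighted_perimeter.

(* Main.v *)
(** Approximate a minimizing sequence by smooth sets. For a smooth set [E] of finite
area and length, keep the components whose closure meets the closed unit disc;
each has width at most its perimeter, so they all lie in a fixed box. On the other
components the density is 1. Among them one has, up to [e], a ratio of length to
area no larger than that of their union; rescaling it by [t >= 1] to the area of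
the union multiplies its length by [t <= t ^ 2], so the rescaled component is no
longer than the union, up to [e], and it can be translated to a fixed region off
the disc. Thus the minimizing sequence may be taken in a fixed box.

In a square of side [s], the smaller of the areas of [E] and of its complement is
at most [s] times the length of the boundary inside. Hence sets in a box with
bounded perimeter are totally bounded in [L^1], and a subsequence converges to
some [F] without loss of area. The perimeter of [F] is at most the infimum because
it is itself defined by relaxation. *)

Require Import Defs.
From mathcomp Require Import all_boot all_order all_algebra.
From mathcomp Require Import all_classical all_reals all_analysis.
From mathcomp Require Import measurable_realfun.
From mathcomp Require Import ring lra.
Import Order.TTheory GRing.Theory Num.Theory.
Import numFieldNormedType.Exports.

Set Implicit Arguments.
Unset Strict Implicit.
Unset Printing Implicit Defensive.

Local Open Scope classical_set_scope.
Local Open Scope ring_scope.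

(** * Caratheodory measurability for the one-dimensional Hausdorff measure *)

Section hausdorff1_caratheodory.
Context {R : realType}.
Implicit Types (A B X : set (R * R)) (p q : R * R).
Local Notation H := (@hausdorff1 R).

(** Smooth sets may be unbounded with infinitely many components, so along a minimizing sequence
    area could escape to infinity. Components can be moved separately because a smooth set is
    locally connected up to its boundary: distinct components have disjoint closures, and their
    boundaries lie in the boundary of the set, so their lengths add up. Rearranging keeps each
    weighted area exactly. The smooth sets of the sequence have area only close to [v]; the
    constraint is recovered in the limit, weighted area being Lipschitz for the [L^1] distance.
    Length is turned into area by projections alone: a set of small length has both coordinate
    projections inside small measurable sets, so many lines parallel to the axes miss it, and a line
    missing the boundary of an open set stays inside or outside that set. The length is an integral
    over the Caratheodory sets of an outer measure, so additivity over pieces of a boundary rests on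
    Borel sets being Caratheodory measurable, which is settled first. *)

Lemma eucl_dist_ge_fst p q : `|p.1 - q.1| <= eucl_dist p q.
Proof.
rewrite -sqrtr_sqr /eucl_dist ler_wsqrtr// lerDl; exact: sqr_ge0.
Qed.

Lemma eucl_dist_ge_snd p q : `|p.2 - q.2| <= eucl_dist p q.
Proof.
rewrite -sqrtr_sqr /eucl_dist ler_wsqrtr// lerDr; exact: sqr_ge0.
Qed.

Lemma eucl_distC p q : eucl_dist p q = eucl_dist q p.
Proof. by rewrite /eucl_dist; congr Num.sqrt; ring. Qed.

Lemma le_hausdorff1 A B : A `<=` B -> (H A <= H B)%E.
Proof. exact: le_outer_measure. Qed.

Lemma hausdorff1_pre_anti (d d' : R) A : d' <= d ->
  (hausdorff1_pre d A <= hausdorff1_pre d' A)%E.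
Proof.
move=> dd'; apply: ereal_inf_le_tmp => _ [U [BU dU] <-].
exists U => //; split=> // k; apply: le_trans (dU k) _.
by rewrite lee_fin.
Qed.

Lemma hausdorff1_pre_le (d : R) A : 0 < d -> (hausdorff1_pre d A <= H A)%E.
Proof. by move=> d0; apply: ereal_sup_ubound; exists d. Qed.

Lemma eucl_diam_ub A p q : A p -> A q -> ((eucl_dist p q)%:E <= eucl_diam A)%E.
Proof.
by move=> Ap Aq; apply: ereal_sup_ubound; right; exists p => //; exists q.
Qed.

(** A covering set of diameter at most [d < e] cannot meet both [A] and [B], so any cover of the
    union splits into a cover of each, with no set counted twice. *)
Lemma hausdorff1_pre_separated (d e : R) A B : d < e ->
  (forall p q, A p -> B q -> e <= eucl_dist p q) ->
  (hausdorff1_pre d A + hausdorff1_pre d B <= hausdorff1_pre d (A `|` B))%E.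
Proof.
move=> de AB; apply: le_ereal_inf_tmp => _ [U [ABU dU] <-].
pose UA k := if `[< exists2 p, A p & U k p >] then U k else set0.
pose UB k := if `[< exists2 p, B p & U k p >] then U k else set0.
have diamUA k : (eucl_diam (UA k) <= d%:E)%E.
  rewrite /UA; case: asboolP => _; first exact: dU.
  by rewrite eucl_diam0; exact: le_trans (eucl_diam_ge0 _) (dU k).
have diamUB k : (eucl_diam (UB k) <= d%:E)%E.
  rewrite /UB; case: asboolP => _; first exact: dU.
  by rewrite eucl_diam0; exact: le_trans (eucl_diam_ge0 _) (dU k).
apply: (@le_trans _ _ (\sum_(k <oo) eucl_diam (UA k)
                       + \sum_(k <oo) eucl_diam (UB k))%E).
  apply: leeD; apply: ereal_inf_lbound.
    exists UA => //; split=> // p Ap; have [k _ Ukp] := ABU p (or_introl Ap).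
    by exists k => //; rewrite /UA asboolT//; exists p.
  exists UB => //; split=> // p Bp; have [k _ Ukp] := ABU p (or_intror Bp).
  by exists k => //; rewrite /UB asboolT//; exists p.
rewrite -nneseriesD; [|by move=> *; exact: eucl_diam_ge0..].
apply: lee_nneseries => [k _ _|k _].
  by rewrite adde_ge0// eucl_diam_ge0.
rewrite /UA /UB; case: asboolP => [[p Ap Up]|_]; case: asboolP => [[q Bq Uq]|_];
  rewrite ?eucl_diam0 ?adde0 ?add0e ?eucl_diam_ge0//.
have := le_trans (eucl_diam_ub Up Uq) (dU k).
by rewrite lee_fin leNgt (lt_le_trans de)// AB.
Qed.

Lemma hausdorff1_separated (e : R) A B : 0 < e ->
  (forall p q, A p -> B q -> e <= eucl_dist p q) ->
  (H A + H B <= H (A `|` B))%E.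
Proof.
move=> e0 AB.
have [->|] := eqVneq (H (A `|` B)) +oo%E; first exact: leey.
rewrite -ltey => Hoo.
have HA : H A \is a fin_num.
  rewrite ge0_fin_numE ?hausdorff1_ge0//.
  by apply: le_lt_trans Hoo; apply: le_hausdorff1; exact: subsetUl.
have HB : H B \is a fin_num.
  rewrite ge0_fin_numE ?hausdorff1_ge0//.
  by apply: le_lt_trans Hoo; apply: le_hausdorff1; exact: subsetUr.
rewrite -leeBrDr//; apply: ge_ereal_sup => _ [d /= d0 <-].
have fA (d' : R) : 0 < d' -> hausdorff1_pre d' A \is a fin_num.
  move=> d'0; rewrite ge0_fin_numE ?hausdorff1_pre_ge0//.
  by apply: le_lt_trans (hausdorff1_pre_le _ d'0) _; rewrite -ge0_fin_numE ?hausdorff1_ge0.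
rewrite leeBrDr// -leeBrDl ?fA//; apply: ge_ereal_sup => _ [d' /= d'0 <-].
rewrite leeBrDl ?fA//.
(* The scale [m] is finer than the arbitrary scales [d] and [d'], and below the separation [e], so
   the estimate at a fixed scale applies to it. *)
pose m := Num.min (Num.min d d') (e / 2).
have m0 : 0 < m by rewrite !lt_min d0 d'0 divr_gt0.
have md : m <= d by rewrite /m !ge_min lexx.
have md' : m <= d' by rewrite /m !ge_min lexx orbT.
have me : m < e by rewrite /m gt_min ltr_pdivrMr// ltr_pMr// ltr1n orbT.
apply: le_trans (leeD (hausdorff1_pre_anti A md) (hausdorff1_pre_anti B md')) _.
apply: le_trans (hausdorff1_pre_separated me AB) _.
exact: hausdorff1_pre_le.
Qed.

(* The shells [1/(k+2) <= g < 1/(k+1)] with indices of equal parity are at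
   positive distance from each other, so their lengths are summable. *)
Lemma caratheodory_lipschitz (g : R * R -> R) :
  (forall p q, g p - g q <= eucl_dist p q) ->
  H.-caratheodory [set p | g p <= 0].
Proof.
move=> gL; set F := [set p | g p <= 0].
apply: le_caratheodory_measurable => X.
change (H (X `&` F) + H (X `&` ~` F) <= H X)%E.
have [->|] := eqVneq (H X) +oo%E; first exact: leey.
rewrite -ltey => HX.
pose a k : R := k.+1%:R^-1.
have adec k : a k.+1 < a k by rewrite ltf_pV2 ?posrE ?ltr0n// ltr_nat.
have a0 k : 0 < a k by rewrite invr_gt0 ltr0n.
pose G k := X `&` [set p | a k <= g p].
pose D k := X `&` [set p | a k.+1 <= g p < a k].
have Gincr k : G k `<=` G k.+1.
  by move=> p [Xp /= akp]; split => //=; apply: le_trans akp; exact: ltW.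
have GX k : (H (G k) <= H X)%E by apply: le_hausdorff1 => p [].
have step k : (H (G k) + H (D k.+1) <= H (G k.+2))%E.
  apply: (@le_trans _ _ (H (G k `|` D k.+1))).
    apply: (@hausdorff1_separated (a k - a k.+1)).
      by rewrite subr_gt0.
    move=> p q [_ /= gp] [_ /= /andP[_ gq]]; apply: le_trans (gL p q).
    by rewrite lerB// ltW.
  apply: le_hausdorff1 => p [Gp|[Xp /= /andP[gp _]]]; last by split.
  by apply/Gincr/Gincr.
have fG k : H (G k) \is a fin_num.
  by rewrite ge0_fin_numE ?hausdorff1_ge0// (le_lt_trans (GX k)).
(* The right side carries two consecutive indices because [step] advances by two, one index for each
   parity; the shells therefore sum to at most [2 * H X]. *)
have sumD n : (\sum_(0 <= k < n) H (D k.+1) + (H (G 0%N) + H (G 1%N))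
    <= H (G n) + H (G n.+1))%E.
  elim: n => [|n IH]; first by rewrite big_nil add0e.
  rewrite big_nat_recr//= addeAC.
  apply: le_trans (leeD IH (lexx _)) _.
  by rewrite addeAC addeC leeD// step.
have Dsum : (\sum_(0 <= k <oo) H (D k.+1) < +oo)%E.
  apply: (@le_lt_trans _ _ (H X + H X)%E).
    apply: lime_le; first by apply: is_cvg_nneseries => *; exact: hausdorff1_ge0.
    apply: nearW => n; apply: le_trans (leeD (GX n) (GX n.+1)).
    by apply: le_trans (sumD n); rewrite leeDl// adde_ge0// hausdorff1_ge0.
  by rewrite lte_add_pinfty.
have tail : (\sum_(N <= k <oo) H (D k.+1))%E @[N --> \oo] --> 0%E.
  by apply: nneseries_tail_cvg => // k _; exact: hausdorff1_ge0.
have cover N : X `&` ~` F `<=`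
    G N.+1 `|` \bigcup_(k in ~` `I_N) D k.+1.
  move=> p [Xp /= /negP]; rewrite -ltNge => gp.
  have [n ngp] : exists n, a n <= g p.
    exists (Num.truncn (g p)^-1); rewrite invf_ple ?posrE//.
    by apply/ltW; rewrite truncnS_gt.
  elim: n ngp => [|n IH] ngp.
    left; split => //=; apply: le_trans ngp.
    by rewrite lef_pV2 ?posrE// ler_nat.
  have [agn|gn] := leP (a n) (g p); first exact: IH.
  have [nN|nN] := leqP n N.
    left; split => //=; apply: le_trans ngp.
    by rewrite lef_pV2 ?posrE// ler_nat !ltnS.
  right; case: n nN gn ngp IH => // n nN gn ngp _.
  exists n; first by move=> /=; apply/negP; rewrite -leqNgt.
  by split => //=; rewrite ngp gn.
(* [X] inside [F] and [G N.+1] are at distance at least [a N.+1], so their lengths add up within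
   [H X]; what remains is the tail of a convergent series. *)
have bnd N : (H (X `&` F)
   + H (X `&` ~` F) <= H X + \sum_(N <= k <oo) H (D k.+1))%E.
  apply: (@le_trans _ _ (H (X `&` F)
     + (H (G N.+1) + \sum_(N <= k <oo) H (D k.+1)))%E).
    apply: leeD => //; apply: le_trans (le_hausdorff1 (@cover N)) _.
    apply: le_trans (outer_measureU2 _ _ _) _; apply: leeD => //.
    exact: (outer_measure_sigma_subadditive_tail _ N (fun k => D k.+1)).
  rewrite addeA leeD//.
  apply: le_trans (@hausdorff1_separated (a N.+1) _ _ (a0 _) _) _.
    move=> p q [_ /= gp] [_ /= gq]; rewrite eucl_distC; apply: le_trans (gL q p).
    by apply: le_trans gq _; rewrite lerDl oppr_ge0.
  by apply: le_hausdorff1 => p [[]|[]].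
have HXf : H X \is a fin_num by rewrite ge0_fin_numE ?hausdorff1_ge0.
rewrite -[leRHS]adde0.
have tl : (H X + \sum_(N <= k <oo) H (D k.+1))%E @[N --> \oo] --> (H X + 0)%E.
  by apply: cvgeD => //; [exact: fin_num_adde_defr|exact: cvg_cst].
rewrite -(cvg_lim _ tl)//.
by apply: lime_ge; [apply/cvg_ex; eexists; exact: tl|apply: nearW => n; exact: bnd].
Qed.

End hausdorff1_caratheodory.

(** * Borel sets are measurable both for length and for area *)

Section plane_measurability.
Context {R : realType}.
Local Notation H := (@hausdorff1 R).
Local Notation BR2 := (measurableTypeR R * measurableTypeR R)%type.

Definition hausdorff1_outer : {outer_measure set (R * R) -> \bar R} := H.

(** The measure that [weighted_length] integrates against, packaged as such so that the integration
    lemmas apply to it. *)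
Definition hausdorff1_measure :
  {measure set (caratheodory_type H) -> \bar R} := hausdorff1_outer.

Definition borel2 (A : set (R * R)) : Prop := @measurable _ BR2 A.

Lemma fst_hausdorff1_measurable :
  measurable_fun [set: caratheodory_type H]
    (fst : caratheodory_type H -> measurableTypeR R).
Proof.
apply: (measurability _ (RGenOInfty.measurableE R)).
move=> _ [_ [a ->] <-]; rewrite setTI.
rewrite (_ : _ @^-1` _ = ~` [set p | p.1 - a <= 0]); last first.
  by apply/seteqP; split => p /=; rewrite in_itv/= andbT subr_le0 ltNge => /negP.
apply: measurableC; apply: caratheodory_lipschitz => p q.
rewrite opprB addrA subrK; apply: le_trans (ler_norm _) _.
exact: eucl_dist_ge_fst.
Qed.

Lemma snd_hausdorff1_measurable :
  measurable_fun [set: caratheodory_type H]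
    (snd : caratheodory_type H -> measurableTypeR R).
Proof.
apply: (measurability _ (RGenOInfty.measurableE R)).
move=> _ [_ [a ->] <-]; rewrite setTI.
rewrite (_ : _ @^-1` _ = ~` [set p | p.2 - a <= 0]); last first.
  by apply/seteqP; split => p /=; rewrite in_itv/= andbT subr_le0 ltNge => /negP.
apply: measurableC; apply: caratheodory_lipschitz => p q.
rewrite opprB addrA subrK; apply: le_trans (ler_norm _) _.
exact: eucl_dist_ge_snd.
Qed.

(** Half-planes are sublevel sets of the 1-Lipschitz functions [p.1 - a] and [p.2 - a], hence
    Caratheodory measurable, and they generate the product sigma-algebra. *)
Lemma borel2_hausdorff1 A : borel2 A -> H.-cara.-measurable A.
Proof.
move=> mA.
have mid : measurable_fun [set: caratheodory_type H]
    (id : caratheodory_type H -> BR2).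
  apply/measurable_fun_pairP; split.
    exact: fst_hausdorff1_measurable.
  exact: snd_hausdorff1_measurable.
by have := mid measurableT A mA; rewrite setTI preimage_id.
Qed.

(** The open set is the countable union of the squares with rational centre and half-side
    [n.+1%:R^-1] that it contains; the other squares are replaced by [set0]. *)
Lemma open_borel2 (A : set (R * R)) : open A -> borel2 A.
Proof.
move=> oA.
pose Q (n : nat) (q r : rat) : set (R * R) :=
  [set p | ball (ratr q : R) n.+1%:R^-1 p.1 /\ ball (ratr r : R) n.+1%:R^-1 p.2].
pose P n q r := if `[< Q n q r `<=` A >] then Q n q r else set0.
have -> : A = \bigcup_n \bigcup_q \bigcup_r P n q r.
  apply/seteqP; split => [p Ap|p [n _ [q _ [r _]]]]; last first.
    by rewrite /P; case: asboolP => // QA; exact: QA.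
  have [e /= e0 eA] := (nbhs_ballP _ _).1 (oA p Ap).
  have [n ne] : exists n : nat, n.+1%:R^-1 < e / 2.
    exists (Num.truncn (e / 2)^-1).
    by rewrite invf_plt ?posrE ?divr_gt0// truncnS_gt.
  have n0 : 0 < n.+1%:R^-1 :> R by rewrite invr_gt0 ltr0n.
  have rat_near (x t : R) : 0 < t -> exists q : rat, ball (ratr q : R) t x.
    move=> t0; have /rat_in_itvoo[q] : x - t < x + t by lra.
    rewrite in_itv/= => /andP[q1 q2]; exists q.
    by rewrite -ball_normE /ball_/= ltr_norml; apply/andP; split; lra.
  have [q pq] := rat_near p.1 _ n0; have [r pr] := rat_near p.2 _ n0.
  exists n => //; exists q => //; exists r => //.
  rewrite /P asboolT//= => z [zq zr]; apply: eA; split => /=.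
    rewrite [e]splitr; apply: (@ball_triangle _ _ (ratr q : R)).
      by apply: ball_sym; apply: le_ball pq; exact: ltW.
    by apply: le_ball zq; exact: ltW.
  rewrite [e]splitr; apply: (@ball_triangle _ _ (ratr r : R)).
    by apply: ball_sym; apply: le_ball pr; exact: ltW.
  by apply: le_ball zr; exact: ltW.
apply: bigcupT_measurable => n; apply: bigcupT_measurable_rat => q.
apply: bigcupT_measurable_rat => r; rewrite /P; case: asboolP => // _.
apply: (@measurableX _ _ (measurableTypeR R) (measurableTypeR R)
  (ball (ratr q : R) n.+1%:R^-1) (ball (ratr r : R) n.+1%:R^-1));
  by apply: open_measurable; apply: ball_open; rewrite invr_gt0 ltr0n.
Qed.

Lemma closed_borel2 (A : set (R * R)) : closed A -> borel2 A.
Proof.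
move=> cA; rewrite /borel2 -(setCK A); apply: measurableC.
by apply: open_borel2; exact: closed_openC.
Qed.

Lemma boundary_closed (E : set (R * R)) : closed (boundary E).
Proof.
rewrite /boundary setDE; apply: closedI; first exact: closed_closure.
exact/open_closedC/open_interior.
Qed.

Lemma boundary_hausdorff1 (E : set (R * R)) : H.-cara.-measurable (boundary E).
Proof. exact: borel2_hausdorff1 (closed_borel2 (boundary_closed (E := E))). Qed.

Lemma borel2_lebesgue2 A : borel2 A -> lebesgue2_measurable A.
Proof. exact: caratheodory_measurable_mu_ext. Qed.

Lemma lebesgue2E A : borel2 A -> lebesgue2 A = lebesgue2_borel A.
Proof. by move=> mA; exact: measurable_mu_extE. Qed.

End plane_measurability.

(** * Similarities and projections *)

Definition simil {R : realType} (t : R) (b p : R * R) : R * R :=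
  (t * p.1 + b.1, t * p.2 + b.2).

Section similarity.
Context {R : realType}.
Implicit Types (A S : set (R * R)) (t : R) (b p q : R * R).
Local Notation H := (@hausdorff1 R).
Local Notation BR2 := (measurableTypeR R * measurableTypeR R)%type.

Lemma similK t b : t != 0 ->
  cancel (simil t b) (simil t^-1 (- b.1 / t, - b.2 / t)).
Proof. by move=> t0 [x y]; rewrite /simil/=; congr pair; field. Qed.

Lemma similVK t b : t != 0 ->
  cancel (simil t^-1 (- b.1 / t, - b.2 / t)) (simil t b).
Proof. by move=> t0 [x y]; rewrite /simil/=; congr pair; field. Qed.

Lemma image_simil t b A : t != 0 ->
  simil t b @` A = simil t^-1 (- b.1 / t, - b.2 / t) @^-1` A.
Proof.
move=> t0; apply/seteqP; split => [_ [p Ap <-]|p Ap]; first by rewrite /= similK.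
by eexists; [exact: Ap|rewrite similVK].
Qed.

Lemma eucl_dist_simil t b p q : 0 < t ->
  eucl_dist (simil t b p) (simil t b q) = t * eucl_dist p q.
Proof.
move=> t0; rewrite /eucl_dist /simil/=.
rewrite [X in Num.sqrt X = _](_ : _ =
  t ^+ 2 * ((p.1 - q.1) ^+ 2 + (p.2 - q.2) ^+ 2)); last by ring.
by rewrite sqrtrM ?sqr_ge0// sqrtr_sqr gtr0_norm.
Qed.

Lemma eucl_diam_simil t b A : 0 < t ->
  (eucl_diam (simil t b @` A) <= t%:E * eucl_diam A)%E.
Proof.
move=> t0; apply: ge_ereal_sup => _ [->|[_ [p Ap <-] [_ [q Aq <-] <-]]].
  by rewrite mule_ge0 ?eucl_diam_ge0// lee_fin ltW.
by rewrite eucl_dist_simil// EFinM lee_pmul2l// ?lte_fin// eucl_diam_ub.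
Qed.

Lemma hausdorff1_simil t b A : 0 < t -> (H (simil t b @` A) <= t%:E * H A)%E.
Proof.
move=> t0; apply: ge_ereal_sup => _ [d /= d0 <-].
apply: (@le_trans _ _ (t%:E * hausdorff1_pre (d / t) A)%E); last first.
  by rewrite lee_pmul2l ?lte_fin// hausdorff1_pre_le// divr_gt0.
rewrite -lee_pdivrMl//; apply: le_ereal_inf_tmp => _ [U [AU dU] <-].
rewrite lee_pdivrMl// -nneseriesZl; last by move=> *; exact: eucl_diam_ge0.
apply: (@le_trans _ _ (\sum_(k <oo) eucl_diam (simil t b @` U k))%E).
  apply: ereal_inf_lbound; exists (fun k => simil t b @` U k) => //; split.
    move=> _ [p Ap <-]; have [k _ Ukp] := AU p Ap.
    by exists k => //; exists p.
  move=> k; apply: le_trans (eucl_diam_simil b (U k) t0) _.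
  by rewrite -lee_pdivlMl// -EFinM mulrC.
apply: lee_nneseries => [k _ _|k _]; first exact: eucl_diam_ge0.
exact: eucl_diam_simil.
Qed.

(** Serves to enclose the projection of a covering set, which may fail to be measurable, in an
    interval no longer than the diameter. *)
Lemma hull_measure (S : set R) (d : R) : 0 <= d ->
  (forall x y, S x -> S y -> x - y <= d) ->
  exists I : set R, [/\ measurable I, (lebesgue_measure I <= d%:E)%E & S `<=` I].
Proof.
move=> d0 Sd; have [->|/set0P[x0 Sx0]] := eqVneq S set0.
  by exists set0; split => //; rewrite measure0 lee_fin.
have ubS : has_ubound S.
  by exists (x0 + d) => y Sy; rewrite -lerBlDl Sd.
have lbS : has_lbound S.
  by exists (x0 - d) => y Sy; rewrite lerBlDr -lerBlDl Sd.
exists `[inf S, sup S]%classic; split.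
- exact: measurable_itv.
- rewrite lebesgue_measure_itv/=; case: ifP => _; last by rewrite lee_fin.
  rewrite -EFinD lee_fin lerBlDr; apply: ge_sup; first by exists x0.
  move=> x Sx; rewrite -lerBlDl; apply: lb_le_inf; first by exists x0.
  by move=> y Sy; rewrite lerBlDr -lerBlDl Sd.
- by move=> x Sx /=; rewrite in_itv/= ge_inf// ub_le_sup.
Qed.

(** Projections do not increase diameters: each set of a cover of total diameter below [c] projects
    into an interval of at most its diameter, and [A] and [B] are the unions of these intervals. *)
Lemma hausdorff1_projections S (c : \bar R) : (H S < c)%E ->
  exists A B : set R, [/\ measurable A, measurable B,
    (lebesgue_measure A < c)%E, (lebesgue_measure B < c)%E &
    forall p, S p -> A p.1 /\ B p.2].
Proof.
move=> HSc; have := le_lt_trans (hausdorff1_pre_le S ltr01) HSc.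
move/ereal_inf_lt => [_ [U [SU dU] <-] Uc].
have fd k : eucl_diam (U k) \is a fin_num.
  by rewrite ge0_fin_numE ?eucl_diam_ge0// (le_lt_trans (dU k))// ltry.
have dist_le k p q : U k p -> U k q -> eucl_dist p q <= fine (eucl_diam (U k)).
  by move=> Up Uq; rewrite -lee_fin fineK// eucl_diam_ub.
have d0 k : 0 <= fine (eucl_diam (U k)) by rewrite fine_ge0// eucl_diam_ge0.
have /choice[IA PA] k : exists I : set R, [/\ measurable I,
    (lebesgue_measure I <= eucl_diam (U k))%E & fst @` U k `<=` I].
  have [] := @hull_measure (fst @` U k) _ (d0 k).
    move=> _ _ [p Up <-] [q Uq <-]; apply: le_trans (dist_le k p q Up Uq).
    by apply: le_trans (ler_norm _) _; exact: eucl_dist_ge_fst.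
  by move=> I; rewrite fineK// => ?; exists I.
have /choice[IB PB] k : exists I : set R, [/\ measurable I,
    (lebesgue_measure I <= eucl_diam (U k))%E & snd @` U k `<=` I].
  have [] := @hull_measure (snd @` U k) _ (d0 k).
    move=> _ _ [p Up <-] [q Uq <-]; apply: le_trans (dist_le k p q Up Uq).
    by apply: le_trans (ler_norm _) _; exact: eucl_dist_ge_snd.
  by move=> I; rewrite fineK// => ?; exists I.
have small (J : (set R)^nat) : (forall k, measurable (J k)) ->
    (forall k, (lebesgue_measure (J k) <= eucl_diam (U k))%E) ->
    (lebesgue_measure (\bigcup_k J k) < c)%E.
  move=> mJ leJ; apply: le_lt_trans Uc.
  apply: (@le_trans _ _ (\sum_(k <oo) lebesgue_measure (J k))%E).
    by apply: measure_sigma_subadditive => //; exact: bigcupT_measurable.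
  by apply: lee_nneseries.
exists (\bigcup_k IA k), (\bigcup_k IB k); split.
- by apply: bigcupT_measurable => k; case: (PA k).
- by apply: bigcupT_measurable => k; case: (PB k).
- by apply: small => k; case: (PA k).
- by apply: small => k; case: (PB k).
- move=> p Sp; have [k _ Up] := SU p Sp; split; exists k => //.
    by case: (PA k) => _ _; apply; exists p.
  by case: (PB k) => _ _; apply; exists p.
Qed.

Lemma affine_measurable (t c : R) :
  measurable_fun [set: measurableTypeR R]
    ((fun x => t * x + c) : measurableTypeR R -> measurableTypeR R).
Proof. by apply: measurable_funD => //; exact: measurable_funM. Qed.

(** Presents a rescaled image measure as a measure known by its values, to which the uniqueness
    theorems for Lebesgue and product measures can be applied. *)
Lemma scaled_pushforward d1 d2 (T1 : measurableType d1) (T2 : measurableType d2)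
  (m : {measure set T1 -> \bar R}) (phi : T1 -> T2) (r : {nonneg R}) :
  measurable_fun [set: T1] phi ->
  exists nu : {measure set T2 -> \bar R},
    forall X : set T2, nu X = (r%:num%:E * m (phi @^-1` X))%E.
Proof.
move=> mphi; have [nu nuE] : exists nu : {measure set T2 -> \bar R},
    forall X : set T2, nu X = m (phi @^-1` X).
  by unshelve eexists (pushforward m phi : {measure set T2 -> \bar R}).
by exists (mscale r nu) => X; rewrite /= /mscale nuE.
Qed.

Lemma lebesgue_measure_affine (t c : R) (A : set (measurableTypeR R)) :
  0 < t -> measurable A ->
  (t%:E * lebesgue_measure ((fun x => (t * x + c)%R) @^-1` A)
   = lebesgue_measure A)%E.
Proof.
move=> t0 mA.
have [nu nuE] := scaled_pushforward lebesgue_measure (NngNum (ltW t0))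
  (affine_measurable t c).
rewrite -[LHS]nuE; apply/esym/lebesgue_measure_unique => // X [[a b]] _ <-.
rewrite [RHS]nuE/= (_ : _ @^-1` _ = `](a - c) / t, (b - c) / t]%classic); last first.
  apply/seteqP; split => x /=;
    by rewrite !in_itv/= ltr_pdivrMr// ler_pdivlMr// ltrBlDr lerBrDr mulrC.
rewrite !lebesgue_measure_itv/= !lte_fin ltr_pM2r ?invr_gt0// ltrD2r.
case: ifP => _; last by rewrite mule0.
by rewrite -!EFinD -EFinM; congr EFin; field; rewrite gt_eqF.
Qed.

Lemma simil_measurable t b :
  measurable_fun [set: BR2] (simil t b : BR2 -> BR2).
Proof.
apply/measurable_fun_pairP; split.
  apply: (measurableT_comp (affine_measurable t b.1)); exact: measurable_fst.
apply: (measurableT_comp (affine_measurable t b.2)); exact: measurable_snd.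
Qed.

Lemma borel2_simil t b A : 0 < t -> borel2 A -> borel2 (simil t b @` A).
Proof.
move=> t0 mA; rewrite image_simil ?gt_eqF//.
by have := simil_measurable t^-1 (- b.1 / t, - b.2 / t) measurableT mA;
  rewrite setTI.
Qed.

(** By uniqueness of the product measure it is enough to look at rectangles, where each side
    contributes one factor [t]. *)
Lemma lebesgue2_borel_simil t b A : 0 < t -> borel2 A ->
  (lebesgue2_borel (simil t b @` A) = (t ^+ 2)%:E * lebesgue2_borel A)%E.
Proof.
move=> t0 mA.
have t20 : 0 <= t ^+ 2 by rewrite sqr_ge0.
have [nu nuE] := scaled_pushforward (@lebesgue2_borel R) (NngNum t20)
  (simil_measurable t b).
rewrite -[X in (_ * _ X)%E](_ : simil t b @^-1` (simil t b @` A) = A); last first.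
  apply/seteqP; split => [p [q Aq]|p Ap]; last by exists p.
  by move/(can_inj (similK b (lt0r_neq0 t0))) => <-.
rewrite -[RHS]nuE; apply: product_measure_unique; last exact: borel2_simil.
move=> X Y mX mY; rewrite [LHS]nuE.
rewrite (_ : _ @^-1` _ = (fun x => t * x + b.1) @^-1` X `*`
  ((fun x => t * x + b.2) @^-1` Y))//.
rewrite [X in (_ * X)%E]product_measure1E/=; last 2 first.
- by have := affine_measurable t b.1 measurableT mX; rewrite setTI.
- by have := affine_measurable t b.2 measurableT mY; rewrite setTI.
rewrite -(lebesgue_measure_affine b.1 t0 mX) -(lebesgue_measure_affine b.2 t0 mY).
by rewrite expr2 EFinM muleACA.
Qed.

End similarity.

(** * Local connectedness of smooth sets *)

(** [s] is the coordinate fixed along a slice and [t] the one that varies. The flag [sw] treats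
    vertical and horizontal slices at once and agrees with the flag [swap] of [strict_side]. *)
Definition pt {R : realType} (sw : bool) (s t : R) : R * R :=
  if sw then (t, s) else (s, t).

Section plane_topology.
Context {R : realType}.
Implicit Types (E U C N : set (R * R)) (x p q : R * R).

Lemma ptN sw (s t : R) : pt (~~ sw) s t = pt sw t s.
Proof. by case: sw. Qed.

Lemma ballRR p (e : R) q :
  ball p e q <-> `|p.1 - q.1| < e /\ `|p.2 - q.2| < e.
Proof. by []. Qed.

Lemma ball_pt sw (s t s' t' e : R) :
  ball (pt sw s t) e (pt sw s' t') <-> `|s - s'| < e /\ `|t - t'| < e.
Proof. by rewrite ballRR; case: sw => /=; split => -[]. Qed.

Lemma pt_continuous sw (s : R) : continuous (pt sw s).
Proof.
move=> t A /nbhs_ballP[e /= e0 eA]; apply/nbhs_ballP; exists e => //= u ut.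
by apply: eA; apply/ball_pt; rewrite subrr normr0.
Qed.

Lemma slice_connected sw s (I : set R) :
  is_interval I -> connected (pt sw s @` I).
Proof.
move=> iI; apply: connected_continuous_connected.
  exact/connected_intervalP.
exact/continuous_subspaceT/pt_continuous.
Qed.

(** [C] is a comb: the line at height [tc] is its spine, and every nonempty slice is a tooth
    reaching it. A point is joined to the spine along its tooth, then to any other point along the
    spine. *)
Lemma connected_comb sw C (tc : R) :
  (forall s, is_interval [set t | C (pt sw s t)]) ->
  is_interval [set s | C (pt sw s tc)] ->
  (forall s t, C (pt sw s t) -> C (pt sw s tc)) -> connected C.
Proof.
move=> Cv Ch Ctc.
have [->|/set0P[p0 Cp0]] := eqVneq C set0; first exact: connected0.
have ptE p : exists s t, p = pt sw s t.
  by case: sw {Cv Ch Ctc}; [exists p.2, p.1|exists p.1, p.2]; case: p.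
have [s0 [t0 p0E]] := ptE p0.
have C0 : C (pt sw s0 tc) by apply: (Ctc _ t0); rewrite -p0E.
suff -> : C = connected_component C (pt sw s0 tc) by exact: component_connected.
apply/seteqP; split; last exact: connected_component_sub.
move=> p Cp; have [s [t pE]] := ptE p.
pose row := pt (~~ sw) tc @` [set s' | C (pt sw s' tc)].
pose col := pt sw s @` [set t' | C (pt sw s t')].
exists (row `|` col); last by right; exists t; rewrite //= -pE.
split; first by left; exists s0; rewrite // ptN.
- by move=> _ [[s' ? <-]|[t' ? <-]] //; rewrite ptN.
- apply: connectedU; [|exact: slice_connected..].
  exists (pt sw s tc); have Cs : C (pt sw s tc) by apply: (Ctc _ t); rewrite -pE.
  by split; [exists s; rewrite // ptN|exists tc].
Qed.

Lemma ball_connected p (e : R) : connected (ball p e).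
Proof.
apply: (@connected_comb false _ p.2) => [s t t' | s s' | s t].
- move=> /ballRR[/= ps pt] /ballRR[/= _ pt'] u /andP[tu ut']; apply/ballRR.
  split=> //=; move: pt pt'; rewrite !ltr_norml => /andP[? ?] /andP[? ?].
  by apply/andP; split; lra.
- move=> /ballRR[/= ps pt] /ballRR[/= ps' _] u /andP[su us']; apply/ballRR.
  split=> //=; move: ps ps'; rewrite !ltr_norml => /andP[? ?] /andP[? ?].
  by apply/andP; split; lra.
- move=> /ballRR[/= ps pt]; apply/ballRR; split => //=; rewrite subrr normr0.
  exact: le_lt_trans (normr_ge0 _) ps.
Qed.

(** An open [E] is also relatively closed in a set that misses its boundary. *)
Lemma connected_avoid_boundary E C : open E -> connected C ->
  C `&` boundary E = set0 -> C `<=` E \/ C `<=` ~` E.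
Proof.
move=> oE cC CE; have [/eqP CE0|/set0P CE0] := boolP (C `&` E == set0).
  by right; exact/disjoints_subset.
left; rewrite -setIidPl; apply: cC => //; first by exists E.
exists (closure E); first exact: closed_closure.
apply/seteqP; split => p [Cp Ep]; split => //; first exact: subset_closure.
apply: contrapT => nEp; have : (C `&` boundary E) p.
  by split => //; split => //; rewrite (interior_id E).1.
by rewrite CE.
Qed.

Lemma slice_avoid_boundary E sw s (I : set R) : open E -> is_interval I ->
  (forall t, I t -> ~ boundary E (pt sw s t)) ->
  forall t t', I t -> I t' -> E (pt sw s t) -> E (pt sw s t').
Proof.
move=> oE iI IE t t' It It' Et.
have avoid : pt sw s @` I `&` boundary E = set0.
  by rewrite -subset0 => _ [[u Iu <-]]; exact: IE Iu.
have := connected_avoid_boundary oE (@slice_connected sw s I iI) avoid.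
move=> [sub|sub]; first by apply: sub; exists t'.
by exfalso; apply: (sub (pt sw s t)) => //; exists t.
Qed.

(** Halving the radius absorbs the factor [sqrt 2] between the max norm and the Euclidean norm. *)
Lemma eucl_dist_lt p q (e : R) : ball p (e / 2) q -> eucl_dist p q < e.
Proof.
move=> /ballRR[h1 h2].
have e0 : 0 < e by have := le_lt_trans (normr_ge0 _) h1; lra.
rewrite -(ltr_pXn2r (n := 2))// ?nnegrE ?sqrtr_ge0 ?ltW//.
rewrite sqr_sqrtr ?addr_ge0 ?sqr_ge0// -[X in X + _]real_normK ?num_real//.
rewrite -[X in _ + X]real_normK ?num_real//.
have := normr_ge0 (p.1 - q.1); have := normr_ge0 (p.2 - q.2).
by move: h1 h2; set a := `|_|; set b := `|_|; nra.
Qed.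

Lemma ball_eucl_dist p q (e : R) : eucl_dist p q < e -> ball p e q.
Proof.
move=> pq; apply/ballRR; split; apply: le_lt_trans pq.
  exact: eucl_dist_ge_fst.
exact: eucl_dist_ge_snd.
Qed.

Lemma smooth_continuous (g : R -> R) : smooth g -> continuous g.
Proof.
move=> sg x; apply: differentiable_continuous; apply/derivable1_diffP.
exact: (sg 0%N).
Qed.

Lemma strict_side_pt sw flip (g : R -> R) s t :
  strict_side sw flip g (pt sw s t) = (if flip then t < g s else g s < t).
Proof. by rewrite /strict_side/=; case: sw. Qed.

(* Near a boundary point, a smooth set is the region on one side of a graph in a
   box so flat that each vertical slice reaches the far horizontal side. *)
Lemma smooth_locally_connected E x : smooth_set E -> closure E x ->
  exists N, nbhs x N /\ connected (N `&` E).
Proof.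
move=> [oE sE] clx; have [Ex|nEx] := pselect (E x).
  have [e /= e0 eE] := (nbhs_ballP _ _).1 (oE x Ex).
  exists (ball x e); split; first exact: nbhsx_ballx.
  by rewrite (setIidl eE); exact: ball_connected.
have [sw [flip [g [r [sg r0 rE]]]]] : exists sw flip g r, [/\ smooth g, 0 < r &
    forall y, eucl_dist x y < r -> (E y <-> strict_side sw flip g y)].
  by apply: sE; split => //; rewrite (interior_id E).1.
have [s0 [t0 xE]] : exists s t, x = pt sw s t.
  by case: (sw); [exists x.2, x.1|exists x.1, x.2]; case: (x).
have gc eta : 0 < eta -> exists2 d, 0 < d &
    forall s, `|s0 - s| < d -> `|g s0 - g s| < eta.
  move=> eta0; have /cvgrPdist_lt/(_ _ eta0) := @smooth_continuous _ sg s0.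
  by move=> /nbhs_ballP[d /= d0 dP]; exists d => // s sd; exact: dP.
pose box d eta := [set p | exists s t, [/\ p = pt sw s t, `|s0 - s| < d & `|t0 - t| < eta]].
have boxN d eta : 0 < d -> 0 < eta -> nbhs x (box d eta).
  move=> d0 eta0; apply/nbhs_ballP; exists (Num.min d eta) => /=.
    by rewrite lt_min d0.
  move=> q; have [s [t qE]] : exists s t, q = pt sw s t.
    by case: (sw); [exists q.2, q.1|exists q.1, q.2]; case: (q).
  rewrite xE qE => /ball_pt; rewrite !lt_min => -[/andP[? _] /andP[_ ?]].
  by exists s, t.
have boxE d eta s t : 0 < d -> 0 < eta -> d <= r / 2 -> eta <= r / 2 ->
    `|s0 - s| < d -> `|t0 - t| < eta ->
    E (pt sw s t) <-> (if flip then t < g s else g s < t).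
  move=> d0 eta0 dr er sd te; rewrite -(strict_side_pt sw); apply: rE.
  apply: eucl_dist_lt; rewrite xE; apply/ball_pt; split.
    exact: lt_le_trans sd dr.
  exact: lt_le_trans te er.
have pt_inj s t s' t' : pt sw s t = pt sw s' t' -> s = s' /\ t = t'.
  by rewrite /pt; case: (sw) => -[-> ->].
have side0 : ~ (if flip then t0 < g s0 else g s0 < t0).
  move=> h; apply: nEx; rewrite xE; apply: (iffRL (boxE (r / 2) (r / 2) _ _ _ _ _ _ _ _) h);
  by rewrite ?subrr ?normr0 ?divr_gt0.
(* If the graph misses [x], then [x] lies strictly beyond it and a box lower than half the gap
   contains no point of [E]; the empty set is connected. *)
have [gt|gt] := eqVneq (g s0) t0; last first.
  pose eta := Num.min (r / 2) (`|g s0 - t0| / 2).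
  have eta0 : 0 < eta by rewrite lt_min !divr_gt0// normr_gt0 subr_eq0.
  have [d1 d10 dg] := gc _ eta0.
  pose d := Num.min (r / 2) d1.
  have d0 : 0 < d by rewrite lt_min d10 divr_gt0.
  have dr : d <= r / 2 by rewrite ge_min lexx.
  have er : eta <= r / 2 by rewrite ge_min lexx.
  exists (box d eta); split; first exact: boxN.
  rewrite (_ : _ `&` _ = set0); first exact: connected0.
  rewrite -subset0 => _ [[s [t [-> sd te]]]] /(boxE _ _ _ _ d0 eta0 dr er sd te).
  have /dg : `|s0 - s| < d1 by apply: lt_le_trans sd _; rewrite ge_min lexx orbT.
  have e2 : eta <= `|g s0 - t0| / 2 by rewrite ge_min lexx orbT.
  move: te e2; rewrite !ltr_norml => /andP[te1 te2] + /andP[ge1 ge2].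
  case: flip side0 {rE boxE} => /negP; rewrite -leNgt => side0 e2 tg.
    by move: e2; rewrite ler0_norm ?subr_le0//; lra.
  by move: e2; rewrite ger0_norm ?subr_ge0//; lra.
pose eta := r / 2.
have eta0 : 0 < eta by rewrite divr_gt0.
have [d1 d10 dg] := gc _ (divr_gt0 eta0 (ltr0n R 2)).
pose d := Num.min (r / 2) d1.
have d0 : 0 < d by rewrite lt_min d10 divr_gt0.
have dr : d <= r / 2 by rewrite ge_min lexx.
have er : eta <= r / 2 by [].
have dg' s : `|s0 - s| < d -> `|g s0 - g s| < eta / 2.
  by move=> sd; apply: dg; apply: lt_le_trans sd _; rewrite ge_min lexx orbT.
exists (box d eta); split; first exact: boxN.
have CE s t : (box d eta `&` E) (pt sw s t) <->
    [/\ `|s0 - s| < d, `|t0 - t| < eta & if flip then t < g s else g s < t].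
  split => [[[s' [t' [/pt_inj[-> ->] sd te]]]]|[sd te h]].
    by move/(boxE _ _ _ _ d0 eta0 dr er sd te).
  split; first by exists s, t.
  exact/(boxE _ _ _ _ d0 eta0 dr er sd te).
(* Over the whole width [g] stays within [eta / 2] of [t0], so the line at distance [eta / 2] from
   [t0], on the side of [E], runs inside [E] and is the spine. *)
apply: (@connected_comb sw _ (if flip then t0 - eta / 2 else t0 + eta / 2)).
- move=> s t t' /CE[sd te h] /CE[_ te' h'] u /andP[tu ut']; apply/CE; split => //.
    by move: te te'; rewrite !ltr_norml => /andP[? ?] /andP[? ?]; apply/andP; split; lra.
  by case: (flip) h h' => h h'; lra.
- move=> s s' /CE[sd te h] /CE[sd' _ h'] u /andP[su us']; apply/CE.
  have ud : `|s0 - u| < d.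
    by move: sd sd'; rewrite !ltr_norml => /andP[? ?] /andP[? ?]; apply/andP; split; lra.
  split => //; have := dg' _ ud; rewrite ltr_norml => /andP[? ?].
  by case: (flip); lra.
- move=> s t /CE[sd te h]; apply/CE; split => //.
    by case: (flip); rewrite ltr_norml; apply/andP; split; lra.
  have := dg' _ sd; rewrite ltr_norml => /andP[? ?].
  by case: (flip); lra.
Qed.

End plane_topology.

(** * Components and elementary isoperimetric estimates *)

Section splitting.
Context {R : realType}.
Implicit Types (E U C N : set (R * R)) (x p q : R * R).

Lemma boundary_open E : open E -> boundary E = closure E `\` E.
Proof. by move=> oE; rewrite /boundary (interior_id E).1. Qed.

Section split.
Variables E U : set (R * R).
Hypotheses (sE : smooth_set E) (oU : open U) (oEU : open (E `\` U)) (UE : U `<=` E).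

(** [U] and its complement in [E] are both open, so the connected trace of [E] near a point of
    [closure U] lies in [U] altogether. Near its closure [U] thus coincides with [E], and inherits
    its boundary and its charts. *)
Lemma split_nbhs x : closure U x -> exists2 N, nbhs x N & N `&` E `<=` U.
Proof.
move=> clUx; have [N [Nx cN]] := smooth_locally_connected sE (closureS UE clUx).
exists N => //; have [z [Uz Nz]] := clUx _ Nx.
suff <- : N `&` E `&` U = N `&` E by move=> p [_].
apply: cN; first by exists z; split => //; split => //; exact: UE.
  by exists U.
exists (~` (E `\` U)); first exact: open_closedC.
apply/seteqP; split => p [[Np Ep] h]; split => //=.
  by move=> [_].
by apply: contrapT => nUp; apply: h; split.
Qed.

Lemma split_boundary : boundary U `<=` boundary E.
Proof.
move=> x; rewrite !boundary_open//; last exact: sE.1.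
move=> [clUx nUx]; split; first exact: closureS clUx.
move=> Ex; apply: nUx; have [N Nx NE] := split_nbhs clUx.
by apply: NE; split => //; exact: nbhs_singleton.
Qed.

Lemma split_closure : closure U `&` closure (E `\` U) = set0.
Proof.
rewrite -subset0 => x [clUx clx]; have [N Nx NE] := split_nbhs clUx.
by have [z [[Ez nUz] Nz]] := clx _ Nx; apply: nUz; apply: NE.
Qed.

Lemma split_smooth : smooth_set U.
Proof.
split => // x Ux; have [sw [flip [g [r [sg r0 rE]]]]] := sE.2 x (split_boundary Ux).
have [N Nx NE] := split_nbhs Ux.1.
have [e /= e0 eN] := (nbhs_ballP _ _).1 Nx.
exists sw, flip, g, (Num.min r e); split => //; first by rewrite lt_min r0.
move=> y; rewrite lt_min => /andP[yr ye]; rewrite -(rE _ yr); split; first exact: UE.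
by move=> Ey; apply: NE; split => //; apply/eN/ball_eucl_dist.
Qed.

End split.

(** Selecting components by a predicate gives the complement in [E] the same form, so that openness
    is proved once for both parts. *)
Definition comps E (P : set (R * R) -> Prop) : set (R * R) :=
  [set y | E y /\ P (connected_component E y)].

Lemma comps_open E P : open E -> open (comps E P).
Proof.
move=> oE; rewrite openE => x [Ex Px]; have [e /= e0 eE] := (nbhs_ballP _ _).1 (oE x Ex).
apply/nbhs_ballP; exists e => //= y xy; split; first exact: eE.
rewrite -(@same_connected_component _ E x y)//.
by exists (ball x e) => //; split => //; [exact: ballxx|exact: ball_connected].
Qed.

Lemma comps_sub E P : comps E P `<=` E. Proof. by move=> x []. Qed.

Lemma comps_setD E P : E `\` comps E P = comps E (fun C => ~ P C).
Proof.
apply/seteqP; split => x [Ex h]; split => //.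
  by move=> Px; apply: h; split.
by move=> [].
Qed.

Lemma component_comps E x : E x ->
  connected_component E x = comps E (fun C => C = connected_component E x).
Proof.
move=> Ex; apply/seteqP; split => y; last first.
  by move=> [Ey <-]; exact: connected_component_refl.
move=> Cy; split; first exact: connected_component_sub Cy.
exact/esym/same_connected_component.
Qed.

Lemma component_open E x : open E -> open (connected_component E x).
Proof.
move=> oE; have [Ex|nEx] := pselect (E x).
  by rewrite component_comps//; exact: comps_open.
by rewrite connected_component_out//; exact: open0.
Qed.

End splitting.

(** * Area and width controlled by the length of the boundary *)

Section isoperimetric_estimates.
Context {R : realType}.
Implicit Types (E U : set (R * R)).
Local Notation H := (@hausdorff1 R).
Local Notation leb := (@lebesgue_measure R).
Local Notation BR2 := (measurableTypeR R * measurableTypeR R)%type.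

(** Half-open, so that the cells of a grid are disjoint and the lengths inside them can be added. *)
Definition cell (a b s : R) : set (R * R) :=
  `[a, a + s[%classic `*` `[b, b + s[%classic.

Lemma borel2X (A B : set R) : measurable A -> measurable B -> borel2 (A `*` B).
Proof. by move=> mA mB; exact: (@measurableX _ _ (measurableTypeR R) (measurableTypeR R)). Qed.

Lemma cell_borel2 a b s : borel2 (cell a b s).
Proof. by apply: borel2X; exact: measurable_itv. Qed.

Lemma lebesgue2_borelX (A B : set R) : measurable A -> measurable B ->
  lebesgue2_borel (A `*` B) = (leb A * leb B)%E.
Proof. by move=> mA mB; exact: product_measure1E. Qed.

Lemma lebesgue_itvco (a s : R) : 0 <= s -> leb `[a, a + s[%classic = s%:E.
Proof.
move=> s0; rewrite lebesgue_measure_itv/= lte_fin ltrDl.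
case: ltrgt0P s0 => // [s0 _|-> _]; last by [].
by rewrite -EFinD addrAC subrr add0r.
Qed.

Lemma itv_escape (I A : set R) : measurable I -> measurable A ->
  (leb A < leb I)%E -> exists2 x, I x & ~ A x.
Proof.
move=> mI mA AI; apply: contrapT => h.
have IA : I `<=` A by move=> x Ix; apply: contrapT => nA; apply: h; exists x.
by have := le_lt_trans (le_measure leb (mem_set mI) (mem_set mA) IA) AI; rewrite ltxx.
Qed.

(* If both a vertical and a horizontal chord of the cell miss the boundary, then
   all such chords carry the same value of [E], so the points where this value is
   not taken project into the projections of the boundary. *)
Lemma cell_isoperimetric E (a b s : R) : 0 < s -> open E ->
  let Q := cell a b s in
  (lebesgue2_borel (Q `\` E) <= s%:E * H (boundary E `&` Q))%E \/
  (lebesgue2_borel (Q `&` E) <= s%:E * H (boundary E `&` Q))%E.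
Proof.
move=> s0 oE Q; set h := H _.
have mE : borel2 E by exact: open_borel2.
have mQ : borel2 Q by exact: cell_borel2.
have lQ : lebesgue2_borel Q = (s%:E * s%:E)%E.
  by rewrite lebesgue2_borelX ?measurable_itv// !lebesgue_itvco// ltW.
(* A boundary of length at least [s] makes the bound as large as the area of the whole cell. *)
have [sh|hs] := leP s%:E h.
  left; apply: (@le_trans _ _ (lebesgue2_borel Q)).
    apply: (le_measure lebesgue2_borel); rewrite ?inE//.
    exact: (@measurableD _ BR2).
  by rewrite lQ lee_pmul2l// lte_fin.
have chord (W : set (R * R)) : (W = E \/ W = ~` E) -> forall sw u (I : set R),
    is_interval I -> (forall t, I t -> ~ boundary E (pt sw u t)) ->
    forall t t', I t -> I t' -> W (pt sw u t) -> W (pt sw u t').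
  move=> [->|->] sw u I iI avoid t t' It It'.
    exact: (slice_avoid_boundary oE iI avoid).
  by move=> nE Et'; apply: nE; exact: (slice_avoid_boundary oE iI avoid It' It).
have iJ (c : R) : is_interval `[c, c + s[%classic.
  by move=> x y /=; rewrite !in_itv/= => /andP[? ?] /andP[? ?] z /andP[? ?];
    rewrite in_itv/=; apply/andP; split; lra.
have [A0 [B0 [mA0 mB0 A0s B0s hAB0]]] := hausdorff1_projections hs.
have [x0 x0I x0A] : exists2 x, `[a, a + s[%classic x & ~ A0 x.
  by apply: itv_escape => //; rewrite lebesgue_itvco// ltW.
have [y0 y0I y0B] : exists2 y, `[b, b + s[%classic y & ~ B0 y.
  by apply: itv_escape => //; rewrite lebesgue_itvco// ltW.
have avoidv x A B : (forall p, (boundary E `&` Q) p -> A p.1 /\ B p.2) ->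
    `[a, a + s[%classic x -> ~ A x ->
    forall t, `[b, b + s[%classic t -> ~ boundary E (pt false x t).
  by move=> hAB Ix nA t It bE; apply: nA; apply: (hAB (x, t) _).1; split.
have avoidh y A B : (forall p, (boundary E `&` Q) p -> A p.1 /\ B p.2) ->
    `[b, b + s[%classic y -> ~ B y ->
    forall t, `[a, a + s[%classic t -> ~ boundary E (pt true y t).
  by move=> hAB Iy nB t It bE; apply: nB; apply: (hAB (t, y) _).2; split.
have main (W : set (R * R)) : (W = E \/ W = ~` E) -> W (x0, y0) -> borel2 W ->
    (lebesgue2_borel (Q `\` W) <= s%:E * h)%E.
  move=> WE W0 mW; have ch := chord _ WE.
  have hf : h \is a fin_num.
    by rewrite ge0_fin_numE ?hausdorff1_ge0// (lt_trans hs)// ltry.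
  rewrite -lee_pdivrMl//; apply/lee_addgt0Pr => e e0.
  (* The first projections only supply a column [x0] missing the boundary. A second pair, of measure
     below [h + e], bounds the bad rows: a row outside [B] misses the boundary and crosses the
     column [x0], hence lies in [W]. *)
  have he : (h < h + e%:E)%E by rewrite lteDl ?lte_fin.
  have [A [B [mA mB Ae Be hAB]]] := hausdorff1_projections he.
  rewrite lee_pdivrMl//; apply: (@le_trans _ _ (lebesgue2_borel (`[a, a + s[%classic `*` B))).
    apply: (le_measure lebesgue2_borel); rewrite ?inE.
    - exact: (@measurableD _ BR2).
    - by apply: borel2X => //; exact: measurable_itv.
    - move=> [x y] [[/= Ix Iy] nW]; split => //=; apply: contrapT => nB; apply: nW.
      have Wv : W (pt true y x0).
        exact: (ch false x0 _ (iJ b) (avoidv x0 _ _ hAB0 x0I x0A) y0 y y0I Iy W0).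
      exact: (ch true y _ (iJ a) (avoidh y _ _ hAB Iy nB) x0 x x0I Ix Wv).
  rewrite lebesgue2_borelX ?measurable_itv// lebesgue_itvco; last exact: ltW.
  by rewrite lee_pmul2l ?lte_fin// ltW.
have [E0|nE0] := pselect (E (x0, y0)).
  by left; apply: main => //; left.
right; rewrite -[X in Q `&` X]setCK -setDE; apply: main => //; first by right.
exact: (@measurableC _ BR2).
Qed.

(** The projection of a connected [E] is an interval. Were it longer than the boundary, a set of
    lines of positive measure would meet [E] and miss its boundary; these lines would lie wholly in
    [E], whose area would be infinite. *)
Lemma connected_width E p q : open E -> connected E ->
  (lebesgue2_borel E < +oo)%E -> E p -> E q ->
  ((p.1 - q.1)%:E <= H (boundary E))%E /\ ((p.2 - q.2)%:E <= H (boundary E))%E.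
Proof.
move=> oE cE Eoo Ep Eq.
have iR : is_interval [set: R] by [].
have inf0 (x : \bar R) : (0 < x)%E -> (x * +oo = +oo)%E by move=> x0; rewrite gt0_muley.
have lebT : leb setT = +oo%E by rewrite -set_itvNyy lebesgue_measure_itv.
have mE : borel2 E by exact: open_borel2.
have gap (A : set R) (u v : R) : measurable A -> (leb A < (u - v)%:E)%E ->
    (0 < leb (`]v, u[%classic `\` A))%E.
  move=> mA Auv; have vu : v < u.
    by rewrite -subr_gt0 -lte_fin (le_lt_trans _ Auv).
  rewrite lt_neqAle measure_ge0 andbT; apply/eqP => h0.
  have : (leb `]v, u[%classic <= leb (`]v, u[%classic `\` A) + leb A)%E.
    rewrite -measureU//; last by rewrite setDE -setIA setICl setI0.
      apply: le_measure; rewrite ?inE.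
      - exact: measurable_itv.
      - by apply: measurableU => //; apply: measurableD => //; exact: measurable_itv.
      - by move=> x Ix; have [Ax|nA] := pselect (A x); [right|left].
    by apply: measurableD => //; exact: measurable_itv.
  by rewrite -h0 add0e lebesgue_measure_itv/= lte_fin vu -EFinD leNgt Auv.
split; rewrite leNgt; apply/negP => /hausdorff1_projections[A [B [mA mB Al Bl hAB]]].
  have mI : measurable (`]q.1, p.1[%classic `\` A).
    by apply: measurableD => //; exact: measurable_itv.
  have : (lebesgue2_borel ((`]q.1, p.1[%classic `\` A) `*` setT) <= lebesgue2_borel E)%E.
    apply: (le_measure lebesgue2_borel); rewrite ?inE//; first exact: borel2X.
    move=> [x y] [[/= /[!in_itv]/= /andP[qx xp] nA] _].
    have : is_interval (fst @` E).
      apply/connected_intervalP; apply: connected_continuous_connected => //.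
      by apply: continuous_subspaceT => z; exact: cvg_fst.
    move=> /(_ q.1 p.1 (ex_intro2 _ _ q Eq erefl) (ex_intro2 _ _ p Ep erefl) x).
    rewrite !ltW// => /(_ isT)[[x' y'] Exy /= xx'].
    apply: (@slice_avoid_boundary _ E false x setT oE iR _ y' y) => //.
      by move=> t _ bE; apply: nA; exact: (hAB (x, t) bE).1.
    by rewrite -xx'.
  rewrite lebesgue2_borelX// lebT inf0 ?gap//.
  by rewrite leye_eq => /eqP Eoo'; rewrite Eoo' in Eoo.
have mI : measurable (`]q.2, p.2[%classic `\` B).
  by apply: measurableD => //; exact: measurable_itv.
have : (lebesgue2_borel (setT `*` (`]q.2, p.2[%classic `\` B)) <= lebesgue2_borel E)%E.
  apply: (le_measure lebesgue2_borel); rewrite ?inE//; first exact: borel2X.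
  move=> [x y] [_ [/= /[!in_itv]/= /andP[qy yp] nB]].
  have : is_interval (snd @` E).
    apply/connected_intervalP; apply: connected_continuous_connected => //.
    by apply: continuous_subspaceT => z; exact: cvg_snd.
  move=> /(_ q.2 p.2 (ex_intro2 _ _ q Eq erefl) (ex_intro2 _ _ p Ep erefl) y).
  rewrite !ltW// => /(_ isT)[[x' y'] Exy /= yy'].
  apply: (@slice_avoid_boundary _ E true y setT oE iR _ x' x) => //.
    by move=> t _ bE; apply: nB; exact: (hAB (t, y) bE).2.
  by rewrite -yy'.
rewrite lebesgue2_borelX// lebT muleC inf0 ?gap//.
by rewrite leye_eq => /eqP Eoo'; rewrite Eoo' in Eoo.
Qed.

End isoperimetric_estimates.

(** * Smooth sets under similarities and separated unions *)

Section similarity_topology.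
Context {R : realType}.
Implicit Types (E A B : set (R * R)) (t : R) (b p q : R * R).

Lemma simil_continuous t b : continuous (simil t b).
Proof.
move=> p A /nbhs_ballP[e /= e0 eA]; apply/nbhs_ballP.
have t1 : 0 < `|t| + 1 by rewrite ltr_wpDl.
exists (e / (`|t| + 1)) => /=; first by rewrite divr_gt0.
have bnd (u v : R) : `|u - v| < e / (`|t| + 1) -> `|t * u - t * v| < e.
  move=> uv; rewrite -mulrBr normrM.
  apply: (@le_lt_trans _ _ ((`|t| + 1) * `|u - v|)).
    by rewrite ler_wpM2r// lerDl.
  by rewrite mulrC -ltr_pdivlMr.
move=> q /ballRR[/bnd q1 /bnd q2]; apply: eA; apply/ballRR; split => /=.
  by rewrite opprD addrACA subrr addr0.
by rewrite opprD addrACA subrr addr0.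
Qed.

Lemma simil_open t b E : t != 0 -> open E -> open (simil t b @` E).
Proof.
move=> t0 oE; rewrite image_simil//; apply: open_comp => // p _.
exact: simil_continuous.
Qed.

Lemma simil_closure t b E : t != 0 ->
  closure (simil t b @` E) = simil t b @` closure E.
Proof.
have sub k c A : simil k c @` closure A `<=` closure (simil k c @` A).
  move=> _ [p clp <-] N Nx.
  have [q [Aq Nq]] := clp _ (simil_continuous Nx).
  by exists (simil k c q); split => //; exists q.
move=> t0; apply/seteqP; split; last exact: sub.
move=> p clp; exists (simil t^-1 (- b.1 / t, - b.2 / t) p); last by rewrite similVK.
have := sub t^-1 (- b.1 / t, - b.2 / t) (simil t b @` E) _ (ex_intro2 _ _ p clp erefl).
rewrite image_comp (_ : _ @` E = E)//; apply/seteqP; split => q.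
  by move=> [q' Eq' <-] /=; rewrite similK.
by move=> Eq; exists q => //=; rewrite similK.
Qed.

Lemma simil_boundary t b E : t != 0 -> open E ->
  boundary (simil t b @` E) = simil t b @` boundary E.
Proof.
move=> t0 oE; rewrite !boundary_open//; last exact: simil_open.
rewrite simil_closure//; apply/seteqP; split => [p [[q clq <-] nE]|_ [q [clq nE] <-]].
  by exists q => //; split => // Eq; apply: nE; exists q.
split; first by exists q.
by move=> [q' Eq' /(can_inj (similK b t0))] qq; apply: nE; rewrite -qq.
Qed.

(** The final [+ 0] gives the derivative the same form as the function, with [derive1 g] for [g], as
    the induction in [smooth_affine] requires. *)
Lemma derive1_affine (a k d c : R) (g : R -> R) :
  (forall x : R, derivable g x 1) ->
  derive1 (fun s => a * g (k * s + d) + c) = (fun s => a * k * derive1 g (k * s + d) + 0)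
  /\ forall x : R, derivable (fun s => a * g (k * s + d) + c) x 1.
Proof.
move=> dg.
have main (x : R) : is_derive x 1 (fun s => a * g (k * s + d) + c)
    (a * k * derive1 g (k * x + d) + 0).
  have dg' : is_derive (k * x + d) 1 g (derive1 g (k * x + d)).
    by rewrite derive1E; exact: DeriveDef.
  have da : is_derive x 1 ((k \*: id) + cst d) k.
    have := is_deriveD (is_deriveZ k (is_derive_id x (1 : R))) (is_derive_cst d x (1 : R)).
    by rewrite addr0 [_ *: _]mulr1.
  have dc : is_derive x 1 (g \o ((k \*: id) + cst d)) (derive1 g (k * x + d) * k).
    exact: is_derive1_comp.
  have : is_derive x 1 ((a \*: (g \o ((k \*: id) + cst d))) + cst c)
      (a *: (derive1 g (k * x + d) * k) + 0).
    exact: (is_deriveD (is_deriveZ a dc) (is_derive_cst c x (1 : R))).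
  move=> dm; rewrite (_ : a * k * _ + 0 = a *: (derive1 g (k * x + d) * k) + 0).
    exact: dm.
  by rewrite -mulrA (mulrC k).
split; last by move=> x; exact: (main x).(ex_derive).
by apply/funext => x; rewrite derive1E; exact: (main x).(derive_val).
Qed.

Lemma smooth_affine (a k d c : R) (g : R -> R) :
  smooth g -> smooth (fun s => a * g (k * s + d) + c).
Proof.
move=> sg n; elim: n a c g sg => [|n IH] a c g sg x.
  exact: (derive1_affine a k d c (sg 0%N)).2.
rewrite derive1Sn (derive1_affine a k d c (sg 0%N)).1.
by apply: IH => m y; have := sg m.+1 y; rewrite derive1Sn.
Qed.

Lemma smooth_simil t b E : 0 < t -> smooth_set E -> smooth_set (simil t b @` E).
Proof.
move=> t0 [oE sE]; have tn0 := lt0r_neq0 t0.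
split; first exact: simil_open.
rewrite simil_boundary// => _ [x /sE[sw [flip [g [r [sg r0 rE]]]]] <-].
(* The translation vector in the coordinates of the chart, where the image of the graph of [g] is
   the graph of [t * g ((s - c.1) / t) + c.2]. *)
pose c := if sw then (b.2, b.1) else b.
exists sw, flip, (fun s => t * g (t^-1 * s + - c.1 / t) + c.2), (t * r).
split; [exact: smooth_affine|exact: mulr_gt0|].
move=> y; rewrite -(similVK b tn0 y); move: (simil t^-1 _ y) => p.
rewrite eucl_dist_simil// ltr_pM2l// => /rE Ep.
apply: (iff_trans _ (iff_trans Ep _)).
  split; last by exists p.
  by move=> [q Eq /(can_inj (similK b tn0)) <-].
have sK (s u : R) : t^-1 * (t * s + u) + - u / t = s by field.
rewrite /strict_side /simil /c; clear -t0 sK; case: p sw => p1 p2 [] /=;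
  by case: flip => /=; rewrite sK ltrD2r (ltr_pM2l t0); split.
Qed.

(** Near a boundary point of one set the other is absent, its closure being disjoint, so the chart
    of the first serves for the union on a smaller disc. *)
Lemma smooth_setU A B : smooth_set A -> smooth_set B ->
  closure A `&` closure B = set0 ->
  smooth_set (A `|` B) /\ boundary (A `|` B) `<=` boundary A `|` boundary B.
Proof.
move=> sA sB AB; have oA := sA.1; have oB := sB.1.
have oAB : open (A `|` B) by exact: openU.
have bnd : boundary (A `|` B) `<=` boundary A `|` boundary B.
  rewrite !boundary_open// closureU => x [[clA|clB] nAB].
    by left; split => // Ax; apply: nAB; left.
  by right; split => // Bx; apply: nAB; right.
have chart A' B' x : smooth_set A' -> closure A' `&` closure B' = set0 ->
    boundary A' x -> exists sw flip g r, [/\ smooth g, 0 < r &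
      forall y, eucl_dist x y < r -> (A' y \/ B' y <-> strict_side sw flip g y)].
  move=> sA' AB' bx; have [sw [flip [g [r [sg r0 rE]]]]] := sA'.2 _ bx.
  have nB : ~ closure B' x.
    move=> clB; suff : (closure A' `&` closure B') x by rewrite AB'.
    by split => //; exact: bx.1.
  have oC : open (~` closure B') by apply: closed_openC; exact: closed_closure.
  have [e /= e0 eB] := (nbhs_ballP _ _).1 (oC x nB).
  exists sw, flip, g, (Num.min r e); split => //; first by rewrite lt_min r0.
  move=> y; rewrite lt_min => /andP[yr ye]; rewrite -(rE _ yr); split; last by left.
  move=> [//|By]; exfalso; apply: (eB y); first exact: ball_eucl_dist.
  exact: subset_closure.
split => //; split => // x /bnd[bA|bB]; first exact: chart.
have [sw [flip [g [r [sg r0 rE]]]]] : exists sw flip g r, [/\ smooth g, 0 < r &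
      forall y, eucl_dist x y < r -> (B y \/ A y <-> strict_side sw flip g y)].
  by apply: chart => //; rewrite setIC.
exists sw, flip, g, r; split => // y /rE <-; split; move=> [?|?]; by [left|right].
Qed.

End similarity_topology.

(** * Integrals of a bounded density *)

Section nonneg_density.
Local Open Scope ereal_scope.
Context d (T : measurableType d) {R : realType} (mu : {measure set T -> \bar R}).
Variables (f : T -> R) (c0 c1 : R).
Hypothesis mf : measurable_fun [set: T] f.
Hypothesis c00 : (0 < c0)%R.
Hypothesis c0f : forall x, (c0 <= f x)%R.
Hypothesis fc1 : forall x, (f x <= c1)%R.
Implicit Types A B : set T.

Lemma density_ge0 x : 0 <= (f x)%:E.
Proof. by rewrite lee_fin (le_trans (ltW c00)). Qed.

Lemma density_measurable A : measurable_fun A (EFin \o f).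
Proof. by apply/measurable_EFinP; exact: measurable_funTS. Qed.

Lemma density_integral_setU A B : measurable A -> measurable B ->
  A `&` B = set0 -> \int[mu]_(x in A `|` B) (f x)%:E =
  \int[mu]_(x in A) (f x)%:E + \int[mu]_(x in B) (f x)%:E.
Proof.
move=> mA mB AB; apply: ge0_integral_setU => //.
- exact: density_measurable.
- by move=> x _; exact: density_ge0.
- by rewrite disj_set2E AB.
Qed.

Lemma density_integral_mono A B : measurable A -> measurable B -> A `<=` B ->
  \int[mu]_(x in A) (f x)%:E <= \int[mu]_(x in B) (f x)%:E.
Proof.
move=> mA mB; apply: ge0_subset_integral => //; first exact: density_measurable.
by move=> x _; exact: density_ge0.
Qed.

Lemma density_integral_lb A : measurable A ->
  c0%:E * mu A <= \int[mu]_(x in A) (f x)%:E.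
Proof.
move=> mA; rewrite -integral_cst//; apply: ge0_le_integral => //.
- by move=> x _; rewrite lee_fin ltW.
- exact: density_measurable.
- by move=> x _; rewrite lee_fin.
Qed.

Lemma density_integral_ub A : measurable A ->
  \int[mu]_(x in A) (f x)%:E <= c1%:E * mu A.
Proof.
move=> mA; rewrite -integral_cst//; apply: ge0_le_integral => //.
- by move=> x _; exact: density_ge0.
- exact: density_measurable.
- by move=> x _; rewrite lee_fin.
Qed.

Lemma density_integral_eq1 A : measurable A -> (forall x, A x -> f x = 1%R) ->
  \int[mu]_(x in A) (f x)%:E = mu A.
Proof.
move=> mA f1; rewrite -[RHS]mul1e -integral_cst//; apply: eq_integral => x.
by rewrite inE => /f1 ->.
Qed.

(** Used in both directions, this makes the weighted area Lipschitz for the [L^1] distance and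
    carries the area constraint through limits. *)
Lemma density_integral_symdiff A B : measurable A -> measurable B ->
  \int[mu]_(x in A) (f x)%:E <=
  \int[mu]_(x in B) (f x)%:E + c1%:E * mu ((A `\` B) `|` (B `\` A)).
Proof.
move=> mA mB; have mD C D : measurable C -> measurable D -> measurable (C `\` D : set T).
  exact: measurableD.
apply: (@le_trans _ _ (\int[mu]_(x in B `|` (A `\` B)) (f x)%:E)).
  apply: density_integral_mono => //; first by apply: measurableU => //; exact: mD.
  by move=> x Ax; have [Bx|nBx] := pselect (B x); [left|right].
rewrite density_integral_setU//; [|exact: mD|by rewrite setDE setICA setICr setI0].
rewrite leeD2l//; apply: le_trans (density_integral_ub (mD _ _ mA mB)) _.
apply: lee_wpmul2l.
  by rewrite lee_fin (le_trans (ltW c00))// (le_trans (c0f point)).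
apply: le_measure; rewrite ?inE; [exact: mD|by apply: measurableU; exact: mD|].
by move=> x; left.
Qed.

Lemma indic_distance A B : measurable A -> measurable B ->
  \int[mu]_x `|\1_A x - \1_B x|%:E = mu ((A `\` B) `|` (B `\` A)).
Proof.
move=> mA mB; rewrite -[X in _ = mu X]setIT -integral_indic//; last first.
  by apply: measurableU; exact: measurableD.
apply: eq_integral => x _; congr EFin; rewrite !indicE.
have [Ax|nAx] := pselect (A x); have [Bx|nBx] := pselect (B x).
- by rewrite (mem_set Ax) (mem_set Bx) subrr normr0 memNset// => -[[]|[]].
- by rewrite (mem_set Ax) (memNset nBx) subr0 normr1 mem_set//; left.
- by rewrite (memNset nAx) (mem_set Bx) sub0r normrN1 mem_set//; right.
- by rewrite (memNset nAx) (memNset nBx) subrr normr0 memNset// => -[[]|[]].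
Qed.

End nonneg_density.

(** * Confinement of a minimizing sequence *)

Section best_component.
Context {R : realType}.
Implicit Types (E F U V : set (R * R)) (x p q : R * R).
Local Notation H := (@hausdorff1 R).
Local Notation BR2 := (measurableTypeR R * measurableTypeR R)%type.

(** Each component is open, hence contains a rational point. Components being equal or disjoint,
    [seqDU] either keeps a component whole or, when it has already occurred, replaces it by the
    empty set. *)
Lemma component_enum E : open E -> exists V : (set (R * R))^nat,
  [/\ trivIset setT V, \bigcup_n V n = E &
      forall n, V n = set0 \/ exists2 x, E x & V n = connected_component E x].
Proof.
move=> oE; pose d n : R * R := if unpickle n is Some (q, r) then
  (ratr (q : rat), ratr (r : rat)) else 0.
pose C n := connected_component E (d n).
exists (seqDU C); split; first exact: trivIset_seqDU.
- rewrite -seqDU_bigcup_eq; apply/seteqP; split => x.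
    by move=> [n _]; exact: connected_component_sub.
  move=> Ex; have : nbhs x (connected_component E x).
    apply: open_nbhs_nbhs; split; first exact: component_open.
    exact: connected_component_refl.
  move=> /nbhs_ballP[e /= e0 eC].
  have rat_near (u : R) : exists q : rat, `|u - ratr q| < e.
    have /rat_in_itvoo[q] : u - e < u + e by lra.
    rewrite in_itv/= => /andP[q1 q2]; exists q.
    by rewrite ltr_norml; apply/andP; split; lra.
  have [q pq] := rat_near x.1; have [r pr] := rat_near x.2.
  exists (pickle (q, r)) => //; rewrite /C /d pickleK.
  by apply: connected_component_sym; apply: eC; apply/ballRR.
- move=> n; have [[m mn]|nCC] := pselect (exists2 m, (m < n)%N & C m `&` C n !=set0).
    move=> [y [Cmy Cny]]; left; rewrite -subset0 => z [Cnz]; apply.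
    rewrite -bigcup_mkord; exists m => //=.
    by rewrite /C (same_connected_component Cmy) -(same_connected_component Cny).
  have [Ed|nEd] := pselect (E (d n)); last first.
    by left; rewrite /seqDU /C connected_component_out// set0D.
  right; exists (d n) => //; apply/seteqP; split => [z []//|z Cz]; split => //.
  by rewrite -bigcup_mkord => -[m /= mn Cm]; apply: nCC; exists m => //; exists z.
Qed.

Lemma split_component F x : smooth_set F -> F x ->
  let V := connected_component F x in
  [/\ open V, open (F `\` V), V `<=` F & smooth_set V].
Proof.
move=> sF Fx V; have oV : open V by apply: component_open; exact: sF.1.
have oFV : open (F `\` V).
  by rewrite /V component_comps// comps_setD; apply: comps_open; exact: sF.1.
have VF : V `<=` F by exact: connected_component_sub.
by split => //; exact: (split_smooth sF).
Qed.

(* If every component had a length-to-area ratio of at least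
   [(H (boundary F) + e) / area F], summing over all components would give
   [H (boundary F) >= H (boundary F) + e]. *)
Lemma best_component F (e : R) : smooth_set F -> 0 < e ->
  (0 < lebesgue2_borel F < +oo)%E -> (H (boundary F) < +oo)%E ->
  exists2 x, F x & (H (boundary (connected_component F x)) * lebesgue2_borel F
    < lebesgue2_borel (connected_component F x) * (H (boundary F) + e%:E))%E.
Proof.
move=> sF e0 /andP[F0 Foo] Hoo; apply: contrapT => nV.
have oF := sF.1; have [V [tV VF VC]] := component_enum oF.
have fH : H (boundary F) \is a fin_num by rewrite ge0_fin_numE ?hausdorff1_ge0.
have fF : lebesgue2_borel F \is a fin_num by rewrite ge0_fin_numE.
have oV n : open (V n).
  have [->|[x Fx ->]] := VC n; first exact: open0.
  by case: (split_component sF Fx).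
have mV n : borel2 (V n) by exact: open_borel2.
have oFV n : open (F `\` V n).
  have [->|[x Fx ->]] := VC n; first by rewrite setD0.
  by case: (split_component sF Fx).
have VsF n : V n `<=` F by rewrite -VF; exact: bigcup_sup.
have bV n : boundary (V n) `<=` boundary F by exact: split_boundary.
(* Disjointness of the boundaries is what allows their lengths to be summed within
   [H (boundary F)]. *)
have tb : trivIset setT (boundary \o V).
  apply/trivIsetP => i j _ _ ij; rewrite -subset0 => x [/= bi bj].
  suff : (closure (V i) `&` closure (F `\` V i)) x.
    by rewrite (split_closure sF (oV i) (oFV i) (@VsF i)).
  split; first exact: bi.1.
  apply: closureS bj.1 => y Vj; split; first exact: VsF Vj.
  move=> Vi; move/trivIsetP : tV => /(_ i j Logic.I Logic.I ij).
  by rewrite -subset0 => /(_ y); apply.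
have mb n : H.-cara.-measurable (boundary (V n)) by exact: boundary_hausdorff1.
have sumb : (\sum_(n <oo) H (boundary (V n)) <= H (boundary F))%E.
  have -> : (\sum_(n <oo) H (boundary (V n)) = H (\bigcup_n boundary (V n)))%E.
    rewrite [RHS](measure_bigcup (@hausdorff1_measure R) _ _ (fun n _ => mb n) tb).
    by apply: eq_eseriesl => n; rewrite in_setT.
  by apply: le_hausdorff1 => x [n _]; exact: bV.
have sumV : (\sum_(n <oo) lebesgue2_borel (V n) = lebesgue2_borel F)%E.
  rewrite -[in RHS]VF [RHS](measure_bigcup lebesgue2_borel _ _ (fun n _ => mV n) tV).
  by apply: eq_eseriesl => n; rewrite in_setT.
have ratio n : (lebesgue2_borel (V n) * (H (boundary F) + e%:E)
    <= H (boundary (V n)) * lebesgue2_borel F)%E.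
  have [->|[x Fx VE]] := VC n; first by rewrite measure0 mul0e mule_ge0 ?hausdorff1_ge0.
  by rewrite leNgt; apply/negP => lt; apply: nV; exists x; last rewrite -VE.
have : ((H (boundary F) + e%:E) * lebesgue2_borel F <= H (boundary F) * lebesgue2_borel F)%E.
  apply: (@le_trans _ _ (\sum_(n <oo) ((H (boundary F) + e%:E) * lebesgue2_borel (V n)))%E).
    have fHe : (H (boundary F) + e%:E)%E \is a fin_num by rewrite fin_numD fH.
    by move: fHe => /fineK <-; rewrite nneseriesZl// sumV.
  apply: (@le_trans _ _ (\sum_(n <oo) (lebesgue2_borel F * H (boundary (V n))))%E).
    apply: lee_nneseries => [n _ _|n _].
      by rewrite mule_ge0// adde_ge0 ?hausdorff1_ge0// lee_fin ltW.
    by rewrite muleC (muleC (lebesgue2_borel F)).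
  move: (fineK fF) => <-; rewrite nneseriesZl; last by move=> *; exact: hausdorff1_ge0.
  by rewrite muleC lee_wpmul2r// fineK.
rewrite lee_pmul2r// -[X in (_ <= X)%E]adde0 leeD2lE// lee_fin leNgt e0.
by [].
Qed.

End best_component.

Definition box {R : realType} (K : R) : set (R * R) :=
  [set p | `|p.1| <= K /\ `|p.2| <= K].

(** * Replacing the far components by a single rescaled one *)

Section rearrangement.
Context {R : realType}.
Implicit Types (E F U V : set (R * R)) (x p q : R * R).
Local Notation H := (@hausdorff1 R).
Local Notation BR2 := (measurableTypeR R * measurableTypeR R)%type.
Variables (f : R * R -> R) (c0 : R).
Hypothesis mf : measurable_fun [set: BR2] (f : BR2 -> measurableTypeR R).
Hypothesis c00 : 0 < c0.
Hypothesis c0f : forall x, c0 <= f x.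
Hypothesis f1 : forall x, 1 < eucl_dist x 0 -> f x = 1.

Lemma density_hausdorff1_measurable :
  measurable_fun [set: caratheodory_type H] (f : caratheodory_type H -> R).
Proof.
move=> _ Y mY; rewrite setTI; apply: borel2_hausdorff1.
by have := mf measurableT mY; rewrite setTI.
Qed.

Lemma density_lebesgue2_measurable :
  measurable_fun [set: caratheodory_type ((@lebesgue2_borel R)^*)%mu]
    (f : caratheodory_type ((@lebesgue2_borel R)^*)%mu -> R).
Proof.
move=> _ Y mY; rewrite setTI; apply: borel2_lebesgue2.
by have := mf measurableT mY; rewrite setTI.
Qed.

Lemma weighted_lengthE C :
  weighted_length f C = (\int[@hausdorff1_measure R]_(x in C) (f x)%:E)%E.
Proof. by []. Qed.

Lemma weighted_length_setU A B : closed A -> closed B -> A `&` B = set0 ->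
  weighted_length f (A `|` B) = (weighted_length f A + weighted_length f B)%E.
Proof.
move=> cA cB AB; rewrite !weighted_lengthE.
apply: (density_integral_setU (@hausdorff1_measure R)
    density_hausdorff1_measurable c00 c0f) => //;
  by apply: borel2_hausdorff1; exact: closed_borel2.
Qed.

Lemma weighted_length_mono A B : closed A -> closed B -> A `<=` B ->
  (weighted_length f A <= weighted_length f B)%E.
Proof.
move=> cA cB AB; rewrite !weighted_lengthE.
apply: (density_integral_mono (@hausdorff1_measure R)
    density_hausdorff1_measurable c00 c0f) => //;
  by apply: borel2_hausdorff1; exact: closed_borel2.
Qed.

Lemma weighted_length_lb A : closed A ->
  (c0%:E * H A <= weighted_length f A)%E.
Proof.
move=> cA; rewrite !weighted_lengthE.
apply: (density_integral_lb (@hausdorff1_measure R) density_hausdorff1_measurable c00 c0f).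
by apply: borel2_hausdorff1; exact: closed_borel2.
Qed.

Lemma weighted_length_outside A : closed A -> (forall x, A x -> 1 < eucl_dist x 0) ->
  weighted_length f A = H A.
Proof.
move=> cA A1; rewrite !weighted_lengthE.
apply: (density_integral_eq1 (@hausdorff1_measure R)).
  by apply: borel2_hausdorff1; exact: closed_borel2.
by move=> x /A1; exact: f1.
Qed.

Lemma weighted_area_setU A B : borel2 A -> borel2 B -> A `&` B = set0 ->
  weighted_area f (A `|` B) = (weighted_area f A + weighted_area f B)%E.
Proof.
move=> mA mB AB.
by apply: (density_integral_setU _ density_lebesgue2_measurable c00 c0f) => //;
  exact: borel2_lebesgue2.
Qed.

Lemma weighted_area_outside A : borel2 A -> (forall x, A x -> 1 < eucl_dist x 0) ->
  weighted_area f A = lebesgue2_borel A.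
Proof.
move=> mA A1; rewrite -lebesgue2E//.
apply: density_integral_eq1; first exact: borel2_lebesgue2.
by move=> x /A1; exact: f1.
Qed.

Lemma component_box F x y (P : R) : smooth_set F -> F x ->
  (lebesgue2_borel F < +oo)%E ->
  let V := connected_component F x in
  (H (boundary V) <= P%:E)%E -> V y -> `|y.1 - x.1| <= P /\ `|y.2 - x.2| <= P.
Proof.
move=> sF Fx Foo V HP Vy; have [oV _ VF _] := split_component sF Fx.
have Vx : V x by exact: connected_component_refl.
have Voo : (lebesgue2_borel V < +oo)%E.
  apply: le_lt_trans Foo; apply: (le_measure lebesgue2_borel); rewrite ?inE //.
    exact: open_borel2.
  by apply: open_borel2; exact: sF.1.
have cV : connected V by exact: component_connected.
have [h1 h2] := connected_width oV cV Voo Vx Vy.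
have [h3 h4] := connected_width oV cV Voo Vy Vx.
have := le_trans h1 HP; have := le_trans h2 HP; have := le_trans h3 HP.
have := le_trans h4 HP; rewrite !lee_fin => *.
by rewrite !ler_norml; split; apply/andP; split; lra.
Qed.

(** In the application [v] and [p] are the area and perimeter of the chosen component, [a] the area
    of the union and [q] its perimeter plus [e]. The strict ratio forces [v] to be positive and
    [t = sqrt (a / v)] works. *)
Lemma scaling_factor (a v p q : R) : 0 <= v -> v <= a -> 0 < a -> 0 <= p ->
  p * a < v * q -> exists t, [/\ 1 <= t, 0 < t, t ^+ 2 * v = a & t * p <= q].
Proof.
move=> v0 va a0 p0 ratio.
have v0' : 0 < v.
  rewrite lt_neqAle v0 andbT; apply/eqP => v0'.
  by move: ratio; rewrite -v0' mul0r ltNge mulr_ge0// ltW.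
pose t := Num.sqrt (a / v).
have t1 : 1 <= t by rewrite -sqrtr1 ler_wsqrtr// ler_pdivlMr// mul1r.
have t2 : t ^+ 2 = a / v by rewrite sqr_sqrtr// divr_ge0// ltW.
exists t; split => //; first exact: lt_le_trans t1.
  by rewrite t2 divfK// gt_eqF.
apply: (@le_trans _ _ (t ^+ 2 * p)).
  by rewrite ler_wpM2r// expr2 ler_peMl// (le_trans _ t1).
by rewrite t2 mulrAC ler_pdivrMr// (mulrC a) (mulrC _ v) ltW.
Qed.

Lemma rearrangement E (P e : R) : smooth_set E -> (lebesgue2_borel E < +oo)%E ->
  (H (boundary E) <= P%:E)%E -> 0 < e -> e <= 1 ->
  exists E', [/\ smooth_set E', E' `<=` box (4 * (P + 3)),
    weighted_area f E' = weighted_area f E &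
    (weighted_length f (boundary E') <= weighted_length f (boundary E) + e%:E)%E].
Proof.
move=> sE Eoo HP e0 e1; have oE := sE.1.
have P0 : 0 <= P by rewrite -lee_fin (le_trans (hausdorff1_ge0 _) HP).
(* The test is on the closure of a component, so that the boundaries of the discarded components
   also stay off the closed disc, where the density is 1. *)
pose nearP C := exists2 z : R * R, closure C z & eucl_dist z 0 <= 1.
pose N := comps E nearP; pose F := E `\` N.
have oN : open N by exact: comps_open.
have FE : F = comps E (fun C => ~ nearP C) by exact: comps_setD.
have oF : open F by rewrite FE; exact: comps_open.
have NE : N `<=` E by exact: comps_sub.
have FsE : F `<=` E by move=> x [].
have oEF : open (E `\` F) by rewrite setDD (setIidr NE).
have sN : smooth_set N by exact: (split_smooth sE oN oF NE).
have sF : smooth_set F by exact: (split_smooth sE oF oEF FsE).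
have bN : boundary N `<=` boundary E by exact: (split_boundary sE oN oF NE).
have bF : boundary F `<=` boundary E by exact: (split_boundary sE oF oEF FsE).
have NF : closure N `&` closure F = set0 by exact: (split_closure sE oN oF NE).
have NF0 : N `&` F = set0 by rewrite /F setDE setICA setICr setI0.
have mN := open_borel2 oN; have mF := open_borel2 oF; have mE := open_borel2 oE.
have EU : E = N `|` F by rewrite /F setDUK.
(* [F] may have infinitely many components, which could accumulate on the disc. But near a limit
   point [E] is connected, so all nearby points of [F] share one component, whose closure would then
   meet the disc. *)
have farF x : closure F x -> 1 < eucl_dist x 0.
  move=> clx; have [M [Mx cM]] := smooth_locally_connected sE (closureS FsE clx).
  have [z [Fz Mz]] := clx _ Mx.
  rewrite ltNge; apply/negP => xle; have : F z by [].
  rewrite FE => -[Ez]; apply; exists x => // W Wx.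
  have [w [Fw [Ww Mw]]] := clx _ (filterI Wx Mx).
  exists w; split => //; exists (M `&` E); last by split => //; exact: FsE.
  by split => //; split.
have Foo : (lebesgue2_borel F < +oo)%E.
  by apply: le_lt_trans Eoo; apply: (le_measure lebesgue2_borel); rewrite ?inE.
have bFP : (H (boundary F) <= P%:E)%E by apply: le_trans HP; exact: le_hausdorff1.
(* One unit for the disc, one to pass from a point of the closure to a point of the component, and
   [P] for the width. *)
have NK : N `<=` box (P + 3).
  move=> y [Ey [z clz z1]].
  have [y' [Vy' zy']] := clz _ (nbhsx_ballx z _ ltr01).
  have VP : (H (boundary (connected_component E y)) <= P%:E)%E.
    apply: le_trans HP; apply: le_hausdorff1.
    have [oV oEV VE _] := split_component sE Ey.
    exact: split_boundary.
  have [h1 h2] := component_box sE Ey Eoo VP Vy'.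
  have := eucl_dist_ge_fst z 0; have := eucl_dist_ge_snd z 0; rewrite /= !subr0.
  move: zy' => /ballRR[]; move: h1 h2; rewrite /box/= !ler_norml !ltr_norml.
  move=> /andP[? ?] /andP[? ?] /andP[? ?] /andP[? ?] /andP[? ?] /andP[? ?].
  by split; apply/andP; split; lra.
have cb (A : set (R * R)) : closed (boundary A) by exact: boundary_closed.
have [F0|F0] := eqVneq (lebesgue2_borel F) 0%E.
  exists N; split => //.
  - by move=> p /NK[? ?]; split; lra.
  - rewrite EU weighted_area_setU// [X in (_ + X)%E]weighted_area_outside// ?F0 ?adde0//.
    by move=> x Fx; apply: farF; exact: subset_closure.
  - by rewrite (le_trans (weighted_length_mono _ _ bN))// leeDl// lee_fin ltW.
have F0' : (0 < lebesgue2_borel F < +oo)%E by rewrite lt0e F0 measure_ge0.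
have bFoo : (H (boundary F) < +oo)%E by rewrite (le_lt_trans bFP)// ltry.
have [x Fx] := best_component sF e0 F0' bFoo.
have [oV oFV VF sV] := split_component sF Fx.
have Vbox := component_box sF Fx Foo.
set V := connected_component F x in oV oFV VF sV Vbox *.
have mV := open_borel2 oV.
have VFle : (lebesgue2_borel V <= lebesgue2_borel F)%E.
  by apply: (le_measure lebesgue2_borel); rewrite ?inE.
have bVF : (H (boundary V) <= H (boundary F))%E.
  by apply: le_hausdorff1; exact: (split_boundary sF oV oFV VF).
have fV : lebesgue2_borel V \is a fin_num by rewrite ge0_fin_numE// (le_lt_trans VFle).
have fF : lebesgue2_borel F \is a fin_num by rewrite ge0_fin_numE.
have fbF : H (boundary F) \is a fin_num by rewrite ge0_fin_numE ?hausdorff1_ge0.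
have fbV : H (boundary V) \is a fin_num.
  by rewrite ge0_fin_numE ?hausdorff1_ge0// (le_lt_trans bVF).
have := hausdorff1_ge0 (boundary V).
have : (0 <= lebesgue2_borel V)%E by exact: measure_ge0.
move: F0' VFle bVF bFP Vbox; have lF := fineK fF; have lV := fineK fV.
have lbF := fineK fbF; have lbV := fineK fbV.
move: lF lV lbF lbV; set a := fine (lebesgue2_borel F).
set v := fine (lebesgue2_borel V); set pF := fine (H (boundary F)).
set p := fine (H (boundary V)) => lF lV lbF lbV.
rewrite -lF -lV -lbF -lbV !lee_fin lte_fin ltry andbT -EFinD -!EFinM lte_fin.
move=> a0 va pF' pFP Vbox v0 p0 ratio.
have [t [t1 t0 t2 tp]] := scaling_factor v0 va a0 p0 ratio.
have [M ME] : exists M, M = P + 3 by eexists.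
(* [x] is sent to [(3 * M, 0)]. The new piece extends at most [P + 1 < M] from there, as [e <= 1],
   so its abscissas lie between [2 * M] and [4 * M], off the disc and off [N], and it stays in the
   box. *)
pose b := (3 * M - t * x.1, - (t * x.2)).
pose G := simil t b @` V.
have sG : smooth_set G by exact: smooth_simil.
have oG := sG.1; have mG := open_borel2 oG.
have Gbox q : G q -> `|q.1 - 3 * M| <= P + 1 /\ `|q.2| <= P + 1.
  move=> [y Vy <-]; have Vp : (H (boundary V) <= p%:E)%E by rewrite lbV.
  have [h1 h2] := Vbox y p Vp Vy.
  have -> : (simil t b y).1 - 3 * M = t * (y.1 - x.1) by rewrite /simil /b/=; ring.
  have -> : (simil t b y).2 = t * (y.2 - x.2) by rewrite /simil /b/=; ring.
  by rewrite !normrM (gtr0_norm t0); split; nra.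
have Gcl q : closure G q -> 2 * M <= q.1.
  have cl : closed (fst @^-1` [set u : R | 2 * M <= u] : set (R * R)).
    apply: closed_comp; last exact: closed_ge.
    by move=> z _; exact: cvg_fst.
  move=> clq; suff : closure (fst @^-1` [set u : R | 2 * M <= u] : set (R * R)) q.
    by rewrite -((closure_id _).1 cl).
  apply: closureS clq => r /Gbox[+ _].
  by rewrite ler_norml /= => /andP[? ?]; lra.
have Ncl q : closure N q -> q.1 <= M.
  have cl : closed (fst @^-1` [set u : R | u <= M] : set (R * R)).
    apply: closed_comp; last exact: closed_le.
    by move=> z _; exact: cvg_fst.
  move=> clq; suff : closure (fst @^-1` [set u : R | u <= M] : set (R * R)) q.
    by rewrite -((closure_id _).1 cl).
  by apply: closureS clq => r /NK[+ _]; rewrite -ME ler_norml => /andP[].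
have NG : closure N `&` closure G = set0.
  rewrite -subset0 => q [/Ncl qN /Gcl qG].
  have M0 : M < 2 * M by lra.
  by have := le_lt_trans qN (lt_le_trans M0 qG); rewrite ltxx.
have Gfar q : closure G q -> 1 < eucl_dist q 0.
  move=> /Gcl qM; have := eucl_dist_ge_fst q 0; rewrite /= subr0 ler_norml.
  by move=> /andP[_ ?]; lra.
have [sNG bNG] := smooth_setU sN sG NG.
have disj (A B : set (R * R)) : closure A `&` closure B = set0 -> boundary A `&` boundary B = set0.
  by move=> AB; rewrite -subset0 -AB => z [[? _] [? _]].
exists (N `|` G); split => //.
- move=> q [/NK[q1 q2]|/Gbox[q1 q2]]; first by split; lra.
  move: q1 q2; rewrite /box/= !ler_norml => /andP[? ?] /andP[? ?].
  by split; apply/andP; split; lra.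
- rewrite [in RHS]EU !weighted_area_setU//; last first.
    by rewrite -subset0 -NG => z [? ?]; split; exact: subset_closure.
  congr (_ + _)%E; rewrite !weighted_area_outside//; last first.
  - by move=> z Gz; apply: Gfar; exact: subset_closure.
  - by move=> z Fz; apply: farF; exact: subset_closure.
  by rewrite [LHS]lebesgue2_borel_simil// -lV -lF -EFinM t2.
- apply: le_trans (weighted_length_mono (cb _) (closedU (cb N) (cb G)) bNG) _.
  rewrite weighted_length_setU//; last exact: disj.
  have wF : weighted_length f (boundary F) = pF%:E.
    by rewrite weighted_length_outside// => z [/farF].
  apply: (@le_trans _ _ (weighted_length f (boundary N) + (pF + e)%:E)%E).
    rewrite leeD2l// weighted_length_outside//; last by move=> z [/Gfar].
    rewrite simil_boundary ?gt_eqF//.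
    apply: le_trans (hausdorff1_simil b (boundary V) t0) _.
    by rewrite -lbV -EFinM lee_fin.
  rewrite EFinD -wF addeA leeD2r// -weighted_length_setU//; last exact: disj.
  by apply: weighted_length_mono => //; [exact: closedU|move=> z [/bN|/bF]].
Qed.

End rearrangement.

(** * Compactness in a box *)

Section compactness.
Context {R : realType}.
Implicit Types (E F : set (R * R)).
Local Notation H := (@hausdorff1 R).
Local Notation BR2 := (measurableTypeR R * measurableTypeR R)%type.
Local Notation mu := (@lebesgue2_borel R).

Definition symdiff E F := (E `\` F) `|` (F `\` E).

Lemma symdiff_borel2 E F : borel2 E -> borel2 F -> borel2 (symdiff E F).
Proof.
by move=> mE mF; apply: (@measurableU _ BR2); exact: (@measurableD _ BR2).
Qed.

(** An ultrafilter finer than [eventually] replaces nested subsequences: each colouring [c j] takes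
    finitely many values, hence is constant on a set of the ultrafilter, and finitely many such sets
    have common elements. *)
Lemma diagonal_choice (T : nat -> finType) (c : forall j, nat -> T j) :
  exists phi : nat -> nat, forall j, (j <= phi j)%N /\
    c j (phi j) = c j (phi j.+1).
Proof.
have [G [uG Goo]] := ultraFilterLemma eventually_filter.
have pG : ProperFilter G by exact: ultra_proper.
have ex j : exists x : T j, G [set n | c j n = x].
  apply: contrapT => nx; have allC (x : T j) : G [set n | c j n <> x].
    have [Gx|//] := in_ultra_setVsetC [set n | c j n = x] uG.
    by exfalso; apply: nx; exists x.
  have /filter_ex[n /(_ (c j n))] : G [set n | forall x : T j, c j n <> x].
    exact: (@filter_forall _ _ (fun x : T j => [set n | c j n <> x]) G _ allC).
  exact.
pose v j := sval (cid (ex j)).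
have vP j : G [set n | c j n = v j] := svalP (cid (ex j)).
(* The index [phi j] has the favoured colours of levels [j] and [j.-1], so [phi j] and [phi j.+1]
   agree at level [j]. For [j = 0] the two requirements coincide. *)
have /choice[phi phiP] j : exists n, [/\ (j <= n)%N, c j n = v j &
    c j.-1 n = v j.-1].
  have : G ([set n | (j <= n)%N] `&`
      ([set n | c j n = v j] `&` [set n | c j.-1 n = v j.-1])).
    by apply: filterI; [exact/Goo/nbhs_infty_ge|exact: filterI].
  by move=> /filter_ex[n [jn [cn cn']]]; exists n.
exists phi => j; have [jphi -> _] := phiP j; split => //.
by have [_ _ /= ->] := phiP j.+1.
Qed.

Definition grid (K s : R) N (ik : 'I_N * 'I_N) : set (R * R) :=
  cell (- K + ik.1%:R * s) (- K + ik.2%:R * s) s.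
Arguments grid : clear implicits.

Lemma grid_disjoint K s N : 0 < s -> trivIset setT (grid K s N).
Proof.
move=> s0; have inj (i k : 'I_N) (u : R) :
    `[- K + i%:R * s, - K + i%:R * s + s[%classic u ->
    `[- K + k%:R * s, - K + k%:R * s + s[%classic u -> (i <= k)%N.
  rewrite /= !in_itv/= => /andP[i1 _] /andP[_ k2].
  rewrite -ltnS -(ltr_nat R) -(ltr_pM2r s0) -[X in _ < X * _]natr1 mulrDl mul1r.
  by lra.
move=> [i k] [i' k'] _ _ [[x y] [[/= x1 y1] [/= x2 y2]]].
by congr pair; apply/val_inj/eqP; rewrite eqn_leq;
  apply/andP; split; (exact: inj x1 x2 || exact: inj x2 x1 ||
    exact: inj y1 y2 || exact: inj y2 y1).
Qed.

Lemma grid_cover K s N p : 0 < s -> 2 * K <= N%:R * s ->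
  - K <= p.1 < K -> - K <= p.2 < K -> exists ik, grid K s N ik p.
Proof.
move=> s0 Ns; have find (u : R) : - K <= u < K -> exists i : 'I_N,
    `[- K + i%:R * s, - K + i%:R * s + s[%classic u.
  move=> /andP[u1 u2]; pose m := Num.truncn ((u + K) / s).
  have uK : 0 <= (u + K) / s by rewrite divr_ge0 ?(ltW s0)//; lra.
  have /andP[m1 m2] := truncn_itv uK.
  rewrite ler_pdivlMr// in m1; rewrite ltr_pdivrMr// -natr1 mulrDl mul1r in m2.
  have mN : (m < N)%N.
    by rewrite -(ltr_nat R) -(ltr_pM2r s0) (le_lt_trans m1)// (lt_le_trans _ Ns)//; lra.
  by exists (Ordinal mN); rewrite /= in_itv/=; apply/andP; split; lra.
move=> /find[i Hi] /find[k Hk]; exists (i, k); case: p Hi Hk => x y Hi Hk.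
by split.
Qed.

Lemma grid_borel2 K s N ik : borel2 (grid K s N ik).
Proof. exact: cell_borel2. Qed.

(** The bit is [true] when the set almost fills the cell; by [cell_isoperimetric], [false] then
    means almost empty. The code is a pattern of pixels, and for a given grid there are finitely
    many. *)
Definition code (s K : R) N E : {ffun 'I_N * 'I_N -> bool} :=
  [ffun ik => `[< (mu (grid K s N ik `\` E)
     <= s%:E * H (boundary E `&` grid K s N ik))%E >]].

Lemma sum_grid_length K s N E : 0 < s ->
  (\sum_(ik \in [set: 'I_N * 'I_N]) H (boundary E `&` grid K s N ik)
   <= H (boundary E))%E.
Proof.
move=> s0; rewrite -(@measure_fin_bigcup _ _ _ (@hausdorff1_measure R)).
- by apply: le_hausdorff1 => p [ik _ []].
- exact: finite_finset.
- by apply: trivIset_setIl; exact: grid_disjoint.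
- move=> ik _; apply: measurableI; first exact: boundary_hausdorff1.
  by apply: borel2_hausdorff1; exact: grid_borel2.
Qed.

(* In each cell the two sets are both almost full or both almost empty, up to an
   area of [s] times the length of their boundaries in that cell. *)
Lemma code_distance (s K P : R) N E F : 0 < s -> 2 * K <= N%:R * s ->
  open E -> open F ->
  (forall p, E p \/ F p -> - K <= p.1 < K /\ - K <= p.2 < K) ->
  (H (boundary E) <= P%:E)%E -> (H (boundary F) <= P%:E)%E ->
  code s K N E = code s K N F ->
  (mu (symdiff E F) <= (2 * s * P)%:E)%E.
Proof.
move=> s0 Ns oE oF EFK EP FP EF.
have mE := open_borel2 oE; have mF := open_borel2 oF.
have mD := symdiff_borel2 mE mF.
have mQ ik := @grid_borel2 K s N ik.
have half (A B C Q : set (R * R)) : borel2 A -> borel2 B -> borel2 C ->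
    C `<=` A `|` B -> (mu C <= mu A + mu B)%E.
  move=> mA mB mC CAB; apply: (@le_trans _ _ (mu (A `|` B))).
    by apply: (le_measure mu); rewrite ?inE//; apply: (@measurableU _ BR2).
  exact: measureU2.
apply: (@le_trans _ _ (\sum_(ik \in [set: 'I_N * 'I_N])
    mu (symdiff E F `&` grid K s N ik))%E).
  apply: content_sub_fsum => //; first exact: finite_finset.
    by move=> ik _; exact: (@measurableI _ BR2 _ _ mD (mQ ik)).
  move=> p Dp; have [h1 h2] : - K <= p.1 < K /\ - K <= p.2 < K.
    by apply: EFK; case: Dp => -[? _]; [left|right].
  by have [ik Qp] := grid_cover s0 Ns h1 h2; exists ik.
apply: (@le_trans _ _ (\sum_(ik \in [set: 'I_N * 'I_N])
    (s%:E * H (boundary E `&` grid K s N ik)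
     + s%:E * H (boundary F `&` grid K s N ik)))%E).
  apply: lee_fsum => [|ik _]; first exact: finite_finset.
  set Q := grid K s N ik; have mQ' : borel2 Q by exact: mQ.
  have mI (A B : set (R * R)) : borel2 A -> borel2 B -> borel2 (A `&` B).
    by move=> mA mB; exact: (@measurableI _ BR2 _ _ mA mB).
  have mDD (A B : set (R * R)) : borel2 A -> borel2 B -> borel2 (A `\` B).
    by move=> mA mB; exact: (@measurableD _ BR2 _ _ mA mB).
  have cE : (mu (Q `\` E) <= s%:E * H (boundary E `&` Q))%E \/
      (mu (Q `&` E) <= s%:E * H (boundary E `&` Q))%E.
    exact: cell_isoperimetric.
  have cF : (mu (Q `\` F) <= s%:E * H (boundary F `&` Q))%E \/
      (mu (Q `&` F) <= s%:E * H (boundary F `&` Q))%E.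
    exact: cell_isoperimetric.
  move/ffunP : EF => /(_ ik); rewrite !ffunE -/Q.
  case: asboolP => [hE /esym/asboolP hF|hE /esym/asboolPn hF].
    apply: le_trans (leeD hE hF).
    apply: half => //; [exact: mDD|exact: mDD|exact: mI|].
    by move=> p [[[Ep nF]|[Fp nE]] Qp]; [right|left].
  have {}hE : (mu (Q `&` E) <= s%:E * H (boundary E `&` Q))%E by case: cE.
  have {}hF : (mu (Q `&` F) <= s%:E * H (boundary F `&` Q))%E by case: cF.
  apply: le_trans (leeD hE hF).
  apply: half => //; [exact: mI|exact: mI|exact: mI|].
  by move=> p [[[Ep nF]|[Fp nE]] Qp]; [left|right].
rewrite (fsbig_split _ _ _ (finite_finset (X := setT)))/=.
rewrite -!ge0_mule_fsumr; try by move=> ik; exact: hausdorff1_ge0.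
rewrite (_ : 2 * s * P = s * P + s * P); last by ring.
by rewrite EFinD EFinM leeD// lee_pmul2l// ?lte_fin//;
  apply: le_trans (sum_grid_length _ _ _ s0) _.
Qed.

(** [F] is the upper limit of the sets. A point lying in no difference [D k] with [n <= k] never
    changes status from [n] on, so [E n] and [F] differ only on the union of these [D k], whose
    measure is a tail of the series. *)
Lemma cauchy_limit (E : (set (R * R))^nat) :
  (forall n, borel2 (E n)) ->
  (\sum_(n <oo) mu (symdiff (E n) (E n.+1)) < +oo)%E ->
  exists F, borel2 F /\ mu (symdiff (E n) F) @[n --> \oo] --> 0%E.
Proof.
move=> mE sumE; pose F := \bigcap_m \bigcup_(k in [set k | (m <= k)%N]) E k.
have mF : borel2 F.
  apply: (@bigcapT_measurable _ BR2) => m.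
  by apply: (@bigcup_measurable _ BR2) => k _; exact: mE.
exists F; split => //.
pose D n := symdiff (E n) (E n.+1).
have mD n : borel2 (D n) by exact: symdiff_borel2.
have sub n : symdiff (E n) F `<=` \bigcup_(k in ~` `I_n) D k.
  move=> p Dp; apply: contrapT => nD.
  have step k : (n <= k)%N -> E n p <-> E k p.
    elim: k => [|k IH]; first by rewrite leqn0 => /eqP ->.
    rewrite leq_eqVlt => /predU1P[-> //|]; rewrite ltnS => nk.
    rewrite (IH nk); have : ~ D k p.
      by move=> Dk; apply: nD; exists k => //=; apply/negP; rewrite -leqNgt.
    move=> nDk; split => h; apply: contrapT => h'; apply: nDk.
      by left.
    by right.
  case: Dp => -[h1 h2].
    apply: h2 => m _; exists (maxn m n); first exact: leq_maxl.
    by apply/step => //; exact: leq_maxr.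
  by have [k /= nk Ek] := h1 n Logic.I; apply/h2/(step k).
apply: (@squeeze_cvge _ _ _ _ (cst 0%E) _ (fun n => \sum_(n <= k <oo) mu (D k))%E).
- apply: nearW => n; rewrite measure_ge0/=.
  apply: (@le_trans _ _ (mu (\bigcup_(k in ~` `I_n) D k))).
    apply: (le_measure mu); rewrite ?inE.
    + exact: symdiff_borel2.
    + by apply: (@bigcup_measurable _ BR2) => k _; exact: mD.
    + exact: sub.
  rewrite bigcup_mkcond.
  apply: (@le_trans _ _ (\sum_(k <oo) mu (if k \in ~` `I_n then D k else set0))%E).
    apply: measure_sigma_subadditive.
    + by move=> k; case: ifP => // _; exact: mD.
    + apply: (@bigcupT_measurable _ BR2) => k; case: ifP => // _; exact: mD.
    + by [].
  rewrite [leRHS]eseries_cond [leRHS]eseries_mkcondr; apply: lee_nneseries => [k _ _|k _].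
    by rewrite measure_ge0.
  by rewrite mem_not_I; case: ifP => // _; rewrite measure0.
- exact: cvg_cst.
- by apply: nneseries_tail_cvg => // k _; exact: measure_ge0.
Qed.

Lemma bounded_compactness (E : (set (R * R))^nat) (K P : R) :
  (forall n, open (E n)) -> (forall n, E n `<=` box K) ->
  (forall n, (H (boundary (E n)) <= P%:E)%E) ->
  exists (phi : nat -> nat) F, [/\ forall j, (j <= phi j)%N, borel2 F &
    mu (symdiff (E (phi j)) F) @[j --> \oo] --> 0%E].
Proof.
move=> oE EK EP.
have P0 : 0 <= P by rewrite -lee_fin (le_trans (hausdorff1_ge0 _) (EP 0%N)).
(* The extra unit puts the closed box of half-side [K] inside the half-open square that the grid
   covers. *)
pose L := `|K| + 1; have L0 : 0 < L by rewrite ltr_wpDl.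
pose s j := 2 * L / (2 ^ j)%:R.
have pw j : 0 < (2 ^ j)%:R :> R by rewrite ltr0n expn_gt0.
have s0 j : 0 < s j by rewrite divr_gt0// mulr_gt0.
have [phi phiP] := @diagonal_choice (fun j => {ffun 'I_(2 ^ j) * 'I_(2 ^ j) -> bool})
  (fun j n => code (s j) L (2 ^ j) (E n)).
(* With [s j = 2 * L / 2 ^ j], the bound [2 * s j * P] is [4 * L * P / 2 ^ j], written with exponent
   [j + 1] to match the geometric series summed below. *)
have step j : (mu (symdiff (E (phi j)) (E (phi j.+1)))
    <= (8 * L * P / (2 ^ (j + 1))%:R)%:E)%E.
  apply: le_trans (@code_distance (s j) L P (2 ^ j) _ _ (s0 j) _ _ _ _ _ _ _) _ => //.
  - by rewrite /s mulrCA divff ?mulr1// gt_eqF.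
  - move=> p h; have {h} : box K p by case: h; exact: EK.
    rewrite /box /= !ler_norml => -[/andP[? ?] /andP[? ?]].
    have := ler_norm K; rewrite /L => ?.
    by split; apply/andP; split; lra.
  - exact: (phiP j).2.
  - rewrite lee_fin /s addn1 expnS natrM le_eqVlt; apply/orP; left; apply/eqP.
    by field; rewrite gt_eqF.
have sumE : (\sum_(j <oo) mu (symdiff (E (phi j)) (E (phi j.+1))) < +oo)%E.
  apply: (@le_lt_trans _ _ (\sum_(j <oo) (8 * L * P / (2 ^ (j + 1))%:R)%:E)%E).
    by apply: lee_nneseries => [j _ _|j _]; [exact: measure_ge0|exact: step].
  have := @cvg_geometric_eseries_half R (8 * L * P) 0%N.
  by rewrite /eseries /= => /cvg_lim -> //; rewrite ltry.
have [F [mF cF]] := @cauchy_limit (fun j => E (phi j))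
  (fun j => open_borel2 (oE (phi j))) sumE.
by exists phi, F; split => // j; exact: (phiP j).1.
Qed.

End compactness.

(** * Existence *)

Section limits.
Context {R : realType}.
Local Open Scope ereal_scope.

Lemma cvge0_near_lt (u : (\bar R)^nat) (e : R) : u @ \oo --> 0 -> (0 < e)%R ->
  \forall n \near \oo, u n < e%:E.
Proof.
move=> /fine_cvgP[ufin /cvgrPdist_lt/(_ e)] ucvg e0.
near=> n.
have uf : u n \is a fin_num by near: n.
rewrite -(fineK uf) lte_fin.
have : (`|0 - fine (u n)| < e)%R by near: n; exact: ucvg.
by rewrite sub0r normrN; apply: le_lt_trans; exact: ler_norm.
Unshelve. all: by end_near. Qed.

Lemma limn_einf_lt (u : (\bar R)^nat) (c : \bar R) N :
  limn_einf u < c -> exists2 n, (N <= n)%N & u n < c.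
Proof.
move=> uc; apply: contrapT => h; move: uc; apply/negP; rewrite -leNgt.
rewrite limn_einf_lim (cvg_lim _ (@cvg_einfs_sup _ u))//.
apply: (@le_trans _ _ (einfs u N)); last by apply: ereal_sup_ubound; exists N.
apply: le_ereal_inf_tmp => _ [n /= Nn <-]; rewrite leNgt; apply/negP => unc.
by apply: h; exists n.
Qed.

Lemma limn_einf_le (u : (\bar R)^nat) (c : \bar R) :
  (forall e : R, (0 < e)%R -> \forall n \near \oo, u n <= c + e%:E) ->
  limn_einf u <= c.
Proof.
move=> uc; rewrite limn_einf_lim (cvg_lim _ (@cvg_einfs_sup _ u))//.
apply: ge_ereal_sup => _ [N _ <-]; apply/lee_addgt0Pr => e e0.
have [n [Nn un]] : exists n, (N <= n)%N /\ u n <= c + e%:E.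
  by apply: (@filter_ex _ \oo); apply: filterI; [exact: nbhs_infty_ge|exact: uc].
by apply: le_trans un; apply: ereal_inf_lbound; exists n.
Qed.

Lemma limn_einf_ge0 (u : (\bar R)^nat) : (forall n, 0 <= u n) -> 0 <= limn_einf u.
Proof.
move=> u0; rewrite limn_einf_lim (cvg_lim _ (@cvg_einfs_sup _ u))//.
apply: (@le_trans _ _ (einfs u 0%N)); last by apply: ereal_sup_ubound; exists 0%N.
by apply: le_ereal_inf_tmp => _ [n /= _ <-].
Qed.

End limits.

Section existence.
Context {R : realType}.
Implicit Types (E F : set (R * R)).
Local Notation H := (@hausdorff1 R).
Local Notation BR2 := (measurableTypeR R * measurableTypeR R)%type.
Local Notation mu := (@lebesgue2_borel R).
Variables (f : R * R -> R) (c0 c1 : R).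
Hypothesis mf : measurable_fun [set: BR2] (f : BR2 -> measurableTypeR R).
Hypothesis c00 : 0 < c0.
Hypothesis c0f : forall x, c0 <= f x.
Hypothesis fc1 : forall x, f x <= c1.
Hypothesis f1 : forall x, 1 < eucl_dist x 0 -> f x = 1.

Lemma c1_gt0 : 0 < c1.
Proof. by apply: lt_le_trans c00 (le_trans (c0f 0) (fc1 0)). Qed.

Lemma perimeter_ge0 F : (0 <= perimeter f F)%E.
Proof.
apply: le_ereal_inf_tmp => _ [Eh _ <-]; apply: limn_einf_ge0 => n.
rewrite weighted_lengthE; apply: integral_ge0 => x _.
by rewrite lee_fin (le_trans (ltW c00)).
Qed.

Lemma weighted_area_symdiff E F : lebesgue2_measurable E -> lebesgue2_measurable F ->
  (weighted_area f E <= weighted_area f F + c1%:E * lebesgue2 (symdiff E F))%E.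
Proof.
move=> mE mF.
exact: (density_integral_symdiff _ (density_lebesgue2_measurable mf) c00 c0f fc1).
Qed.

Lemma weighted_area_lb E : borel2 E -> (c0%:E * mu E <= weighted_area f E)%E.
Proof.
move=> mE; rewrite -lebesgue2E//.
apply: (density_integral_lb _ (density_lebesgue2_measurable mf) c00 c0f).
exact: borel2_lebesgue2.
Qed.

Lemma L1_distance E F : lebesgue2_measurable E -> lebesgue2_measurable F ->
  (\int[lebesgue2]_x `|\1_E x - \1_F x|%:E)%E = lebesgue2 (symdiff E F).
Proof. by move=> mE mF; exact: indic_distance. Qed.

Lemma symdiffC E F : symdiff E F = symdiff F E.
Proof. by rewrite /symdiff setUC. Qed.

Lemma exists_area (v : R) : 0 < v ->
  exists E, lebesgue2_measurable E /\ weighted_area f E = v%:E.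
Proof.
move=> v0; pose E := `[2, 2 + v[%classic `*` `[0, 0 + 1[%classic : set (R * R).
have mE : borel2 E by apply: borel2X; exact: measurable_itv.
exists E; split; first exact: borel2_lebesgue2.
rewrite (weighted_area_outside f1)//.
  by rewrite lebesgue2_borelX ?measurable_itv// !lebesgue_itvco ?ltW// mule1.
move=> x [/= + _]; rewrite in_itv/= => /andP[x2 _].
have := eucl_dist_ge_fst x 0; rewrite /= subr0.
by apply: lt_le_trans; apply: lt_le_trans (ler_norm _); lra.
Qed.

(** A smooth approximation of [F] is rearranged. Its weighted length is below [r + e <= r + 1],
    whence the bound [(r + 1) / c0] on its Hausdorff length and the size of the box; the second [e]
    is the cost of the rearrangement. *)
Lemma almost_minimizer F (v r e : R) : lebesgue2_measurable F ->
  weighted_area f F = v%:E -> 0 < v -> 0 <= r -> 0 < e -> e <= 1 ->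
  (perimeter f F < (r + e)%:E)%E ->
  exists E', [/\ smooth_set E', E' `<=` box (4 * ((r + 1) / c0 + 3)),
    (weighted_length f (boundary E') <= (r + e + e)%:E)%E,
    (weighted_area f E' <= v%:E + (c1 * e)%:E)%E &
    (v%:E <= weighted_area f E' + (c1 * e)%:E)%E].
Proof.
move=> mF wF v0 r0 e0 e1 /ereal_inf_lt[_ [Eh [sEh cEh] <-] lEh].
(* One index must serve two purposes: the distance to [F] is small from [N] on, and a lower limit
   below [r + e] provides such lengths beyond any [N]. *)
have [N _ distN] := cvge0_near_lt cEh e0.
have [n Nn wl] := limn_einf_lt N lEh.
have {cEh lEh distN} dist := distN n Nn; have sE := sEh n.
move: (Eh n) dist wl sE => E dist wl sE {Eh sEh N n Nn}.
have mE : lebesgue2_measurable E by apply: borel2_lebesgue2; apply: open_borel2; exact: sE.1.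
rewrite L1_distance// in dist.
have ce : (c1%:E * lebesgue2 (symdiff E F) <= (c1 * e)%:E)%E.
  by rewrite EFinM lee_pmul2l ?lte_fin ?c1_gt0// ltW.
have wE : (weighted_area f E <= v%:E + (c1 * e)%:E)%E.
  by apply: le_trans (weighted_area_symdiff mE mF) _; rewrite wF leeD2l.
have wE' : (v%:E <= weighted_area f E + (c1 * e)%:E)%E.
  rewrite -wF; apply: le_trans (weighted_area_symdiff mF mE) _.
  by rewrite symdiffC leeD2l.
have muE : (mu E < +oo)%E.
  have h := weighted_area_lb (open_borel2 sE.1).
  have := le_trans h wE; rewrite -lee_pdivlMl// => /le_lt_trans; apply.
  by rewrite -EFinD -EFinM ltry.
have HE : (H (boundary E) <= ((r + 1) / c0)%:E)%E.
  have := weighted_length_lb mf c00 c0f (boundary_closed (E := E)).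
  move=> h; have := le_trans h (ltW wl); rewrite -lee_pdivlMl// => /le_trans; apply.
  by rewrite -EFinM lee_fin mulrC ler_pM2r ?invr_gt0//; lra.
have [E' [sE' E'K wEE' wlE']] := rearrangement mf c00 c0f f1 sE muE HE e0 e1.
exists E'; rewrite wEE'; split; [exact: sE'|exact: E'K| |exact: wE|exact: wE'].
by apply: le_trans wlE' _; rewrite [in leRHS]EFinD leeD2r// ltW.
Qed.

Theorem isoperimetric_existence (v : R) : 0 < v ->
  exists E, isoperimetric_set f v E.
Proof.
move=> v0; pose S F := lebesgue2_measurable F /\ weighted_area f F = v%:E.
have [F0 [mF0 wF0]] := exists_area v0.
pose m := ereal_inf [set perimeter f F | F in S].
have mS F : S F -> (m <= perimeter f F)%E.
  by move=> SF; apply: ereal_inf_lbound; exists F.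
have m0 : (0 <= m)%E.
  by apply: le_ereal_inf_tmp => _ [F _ <-]; exact: perimeter_ge0.
(* Here every competitor has infinite perimeter and any set of area [v] is minimal, which spares
   computing the perimeter of [F0]. *)
have [moo|] := eqVneq m +oo%E.
  exists F0; split; [exact: mF0|exact: wF0|move=> F mF wF]; have : (m <= perimeter f F)%E by exact: mS.
  by rewrite moo leye_eq => /eqP ->; exact: leey.
rewrite -ltey => mfin.
have fm : m \is a fin_num by rewrite ge0_fin_numE.
pose r := fine m; have rE : r%:E = m by rewrite fineK.
have r0 : 0 <= r by rewrite fine_ge0.
pose e n : R := n.+1%:R^-1.
have e0 n : 0 < e n by rewrite invr_gt0 ltr0n.
have e1 n : e n <= 1 by rewrite invf_le1 ?ltr0n// ler1n.
have /choice[E EP] n : exists E', [/\ smooth_set E',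
    E' `<=` box (4 * ((r + 1) / c0 + 3)),
    (weighted_length f (boundary E') <= (r + e n + e n)%:E)%E,
    (weighted_area f E' <= v%:E + (c1 * e n)%:E)%E &
    (v%:E <= weighted_area f E' + (c1 * e n)%:E)%E].
  have : (m < (r + e n)%:E)%E by rewrite EFinD rE lteDl// lte_fin.
  move=> /ereal_inf_lt[_ [F [mF wF] <-] pF].
  exact: (almost_minimizer mF wF).
have HE n : (H (boundary (E n)) <= ((r + 2) / c0)%:E)%E.
  have [_ _ wl _ _] := EP n.
  have := weighted_length_lb mf c00 c0f (boundary_closed (E := E n)).
  move=> h; have := le_trans h wl; rewrite -lee_pdivlMl// => /le_trans; apply.
  rewrite -EFinM lee_fin mulrC ler_pM2r ?invr_gt0//.
  by have := e1 n; lra.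
have oE n : open (E n) by have [[]] := EP n.
have EK n : E n `<=` box (4 * ((r + 1) / c0 + 3)) by have [] := EP n.
have [phi [F [phij mF cF]]] := bounded_compactness oE EK HE.
have mE n : lebesgue2_measurable (E n).
  by apply: borel2_lebesgue2; exact: open_borel2.
have mF' : lebesgue2_measurable F by exact: borel2_lebesgue2.
have distE n : lebesgue2 (symdiff (E n) F) = mu (symdiff (E n) F).
  by apply: lebesgue2E; apply: symdiff_borel2 => //; exact: open_borel2.
have ephi (d : R) : 0 < d -> \forall j \near \oo, e (phi j) < d.
  move=> d0; near=> j; apply: (@le_lt_trans _ _ (e j)).
    by rewrite lef_pV2 ?posrE ?ltr0n// ler_nat ltnS.
  by near: j; exact: (near_infty_natSinv_lt (PosNum d0)).
have small (d : R) : 0 < d -> exists j, ((c1 * e (phi j))%:E +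
    c1%:E * mu (symdiff (E (phi j)) F) <= d%:E)%E.
  move=> d0; have d2 : 0 < d / 2 / c1 by rewrite !divr_gt0// c1_gt0.
  have [j [j1 j2]] : exists j, e (phi j) < d / 2 / c1 /\
      (mu (symdiff (E (phi j)) F) < (d / 2 / c1)%:E)%E.
    apply: (@filter_ex _ \oo); apply: filterI; first exact: ephi.
    exact: (cvge0_near_lt cF d2).
  exists j; rewrite [d in leRHS]splitr EFinD leeD//.
    by rewrite lee_fin -ler_pdivlMl ?c1_gt0// mulrC ltW.
  by rewrite -lee_pdivlMl ?c1_gt0// -EFinM mulrC ltW.
(* Two errors vanish: the area defect of [E (phi j)], at most [c1 * e (phi j)], and [c1] times the
   area of its symmetric difference with [F]. *)
have wF : weighted_area f F = v%:E.
  apply/eqP; rewrite eq_le; apply/andP; split; apply/lee_addgt0Pr => d d0;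
      have [j dj] := small d d0; have [_ _ _ w1 w2] := EP (phi j).
    apply: le_trans (weighted_area_symdiff mF' (mE (phi j))) _.
    apply: le_trans (leeD2r _ w1) _.
    by rewrite symdiffC distE -addeA leeD2l.
  apply: le_trans w2 _.
  apply: le_trans (leeD2r _ (weighted_area_symdiff (mE (phi j)) mF')) _.
  by rewrite distE -addeA leeD2l// addeC.
exists F; split; [exact: mF'|exact: wF|move=> G mG wG]; apply: le_trans (mS G (conj mG wG)).
apply: (@le_trans _ _ (limn_einf (fun j => weighted_length f (boundary (E (phi j)))))).
  apply: ereal_inf_lbound; exists (fun j => E (phi j)) => //; split.
    by move=> j; have [] := EP (phi j).
  rewrite /cvg_L1; under eq_fun do rewrite L1_distance// distE.
  exact: cF.
apply: limn_einf_le => d d0; near=> j.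
have [_ _ wl _ _] := EP (phi j); apply: le_trans wl _.
rewrite -rE -EFinD lee_fin -addrA lerD2l [d]splitr.
by rewrite lerD// ltW//; near: j; apply: ephi; rewrite divr_gt0.
Unshelve. all: by end_near. Qed.

End existence.

(** * Measurability of the ball density *)

Section ball.
Context {R : realType}.
Local Notation BR2 := (measurableTypeR R * measurableTypeR R)%type.

Lemma eucl_dist0_measurable :
  measurable_fun [set: BR2] ((fun x => eucl_dist x 0) : BR2 -> measurableTypeR R).
Proof.
rewrite /eucl_dist; apply: (@measurableT_comp _ _ _ BR2 (measurableTypeR R)
  (measurableTypeR R) (@Num.sqrt R)).
  by apply: continuous_measurable_fun; exact: sqrt_continuous.
apply: measurable_funD; by apply: measurable_funX; apply: measurable_funB.
Qed.

Lemma ball_density_measurable (lambda : R) :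
  measurable_fun [set: BR2] (ball_density lambda : BR2 -> measurableTypeR R).
Proof.
apply: measurable_fun_ifT => //.
  by apply: measurable_fun_ltr => //; exact: eucl_dist0_measurable.
apply: measurable_fun_ifT => //.
by apply: measurable_fun_ltr => //; exact: eucl_dist0_measurable.
Qed.

End ball.

Theorem theorem3p18 (R : realType) (lambda : R) (hlambda : 0 < lambda)
    (hlambda1 : lambda != 1) (v : R) (hv : 0 < v) :
  exists E : set (R * R), isoperimetric_set (ball_density lambda) v E.
Proof.
apply: (@isoperimetric_existence R _ (Num.min 1 lambda) (Num.max 1 lambda)) => //.
- exact: ball_density_measurable.
- by rewrite lt_min ltr01.
- move=> x; rewrite /ball_density; case: ifP => _; first by rewrite ge_min lexx orbT.
  by case: ifP => _ //; rewrite ge_min lexx.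
- move=> x; rewrite /ball_density; case: ifP => _; first by rewrite le_max lexx orbT.
  by case: ifP => _; [rewrite le_max lexx|rewrite ge_min le_max lexx].
- by move=> x x1; rewrite /ball_density ltNge (ltW x1)/= x1.
Qed.
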